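(* Let $M$ be an integral domain and $G$ a countable subgroup of the unit group of $M$ such that $M$ is a finitely generated $\mathbb{Z}[G]$-algebra. Then the induced action of $G$ on $X=\widehat{M}$ is expansive if and only if $v|_G$ is non-trivial (that is, $v(G)\neq\{0\}$) for all $v\in\mathcal{V}_\infty(M_G)\cup\mathcal{V}_{\mathcal{Z}}(M)$.
   Context: Induced action: for a subgroup $G$ of the unit group of the integral domain $M$, $M$ is a $\mathbb{Z}[G]$-algebra via the natural ring homomorphism $\mathbb{Z}[G]\to M$ extending the inclusion $G\subset M$. Give the additive group of $M$ the discrete topology and let $X=\widehat{M}$ be its (compact abelian) Pontryagin dual. For $g\in G$ let $\alpha_g$ be the automorphism of $X$ dual to multiplication by $g$ on $M$; this defines the induced action $\alpha$ of $G$ on $X$. Expansiveness: the action is expansive if there is a neighbourhood $N$ of $0$ in $X$ such that $\bigcap_{g\in G}\alpha_g(N)=\{0\}$. $M_G$ denotes the smallest subring of $M$ containing $G$ (the image of $\mathbb{Z}[G]$ in $M$). Logarithmic maps: for a ring homomorphism $\phi:M_G\to\mathbb{C}$ (with $\phi(1)=1$), the corresponding logarithmic map $v_\phi:M_G\to\mathbb{R}\cup\{\infty\}$ is $v_\phi(a)=\log|\phi(a)|$ (with a formal infinite value when $\phi(a)=0$). $\mathcal{V}_\infty(M_G)$ is the set of all $v_\phi$ as $\phi$ runs through all ring homomorphisms $M_G\to\mathbb{C}$. Valuations: let $k$ be the field of fractions of $M$. For a subring $R\subset k$, $\mathrm{Zar}(k,R)$ denotes the set of all valuation rings of $k$ (i.e.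 subrings $V\subset k$ such that $x\in V$ or $x^{-1}\in V$ for every $x\in k^\times$) which contain $R$. Take $R=\mathbb{Z}$ if $k$ has characteristic zero and $R=\mathbb{F}_p$ if $k$ has characteristic $p>0$, and set $\mathcal{Z}=\mathrm{Zar}(k,R)\setminus\mathrm{Zar}(k,M)$, i.e. the valuation rings of $k$ that do not contain $M$. $\mathcal{V}_{\mathcal{Z}}(M)$ is the collection of (Krull) valuations $v:k\to H\cup\{\infty\}$, with $H$ an ordered abelian group (written additively, depending on $v$), corresponding to the valuation rings in $\mathcal{Z}$; so the valuation ring of $v$ is $\{x\in k: v(x)\geq 0\}$. *)

(* Defs.v *)
From HB Require Import structures.
From mathcomp Require Import all_boot all_order all_algebra.
From mathcomp Require Import all_classical all_reals all_analysis.
From mathcomp Require Import complex.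

Set Implicit Arguments.
Unset Strict Implicit.
Unset Printing Implicit Defensive.

Import Order.TTheory GRing.Theory Num.Theory.
Import numFieldNormedType.Exports.

Local Open Scope classical_set_scope.
Local Open Scope ring_scope.

(* The multiplicative group of elements of norm 1 with the subspace topology,
   instantiated below at the complex numbers [C := R[i]].  The library's
   topological abelian groups are additive, so complex multiplication is
   written [+] here and the neutral element [0] is the number 1. *)
Record circle (C : numFieldType) := Circle {
  circle_val : C;
  circle_norm : `|circle_val| == 1 }.

HB.instance Definition _ (C : numFieldType) := [isSub for @circle_val C].
HB.instance Definition _ (C : numFieldType) := [Choice of circle C by <:].
HB.instance Definition _ (C : numFieldType) := Topological.copy (circle C)
  (initial_topology (@circle_val C : circle C -> C)).

Section Circle.
Context {C : numFieldType}.
Implicit Types z w : circle C.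

Fact circle1_subproof : `|1 : C| == 1.
Proof. by rewrite normr1. Qed.

Fact circleM_subproof z w : `|circle_val z * circle_val w| == 1.
Proof. by rewrite normrM !(eqP (circle_norm _)) mulr1. Qed.

Fact circleV_subproof z : `|(circle_val z)^-1| == 1.
Proof. by rewrite normfV (eqP (circle_norm _)) invr1. Qed.

Definition circle_one : circle C := Circle circle1_subproof.
Definition circle_mul z w : circle C := Circle (circleM_subproof z w).
Definition circle_inv z : circle C := Circle (circleV_subproof z).

Fact circle_val_neq0 z : circle_val z != 0.
Proof. by rewrite -normr_eq0 (eqP (circle_norm _)) oner_eq0. Qed.

Fact circle_mulA : associative circle_mul.
Proof. by move=> x y z; apply: val_inj; exact: mulrA. Qed.

Fact circle_mulC : commutative circle_mul.
Proof. by move=> x y; apply: val_inj; exact: mulrC. Qed.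

Fact circle_mul1 : left_id circle_one circle_mul.
Proof. by move=> x; apply: val_inj; exact: mul1r. Qed.

Fact circle_mulV : left_inverse circle_one circle_inv circle_mul.
Proof. by move=> x; apply: val_inj; exact: mulVf (circle_val_neq0 x). Qed.

HB.instance Definition _ := GRing.isZmodule.Build (circle C)
  circle_mulA circle_mulC circle_mul1 circle_mulV.

Lemma circle_val_continuous : continuous (@circle_val C).
Proof. exact: initial_continuous. Qed.

Lemma circle_add_continuous :
  continuous (fun zw : circle C * circle C => zw.1 + zw.2).
Proof.
apply: continuous_comp_initial => -[z w].
apply: (@cvgM _ _ _ _ (fun zw : circle C * circle C => circle_val zw.1)
                      (fun zw : circle C * circle C => circle_val zw.2)).
  by apply: cvg_comp; [exact: cvg_fst | exact: circle_val_continuous].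
by apply: cvg_comp; [exact: cvg_snd | exact: circle_val_continuous].
Qed.

Lemma circle_opp_continuous : continuous (-%R : circle C -> circle C).
Proof.
apply: continuous_comp_initial => z.
exact: (cvgV (circle_val_neq0 z) (@circle_val_continuous z)).
Qed.

HB.instance Definition _ := PreTopologicalNmodule_isTopologicalNmodule.Build
  (circle C) circle_add_continuous.
HB.instance Definition _ := TopologicalNmodule_isTopologicalZmodule.Build
  (circle C) circle_opp_continuous.

End Circle.

(* Characters of [A], i.e. continuous homomorphisms [A -> circle C]. *)
Record dual (C : numFieldType) (A : topologicalZmodType) := Dual {
  dual_fun :> A -> circle C;
  dual_continuous : continuous dual_fun;
  dualD : {morph dual_fun : a b / a + b} }.

HB.instance Definition _ (C : numFieldType) (A : topologicalZmodType) :=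
  gen_eqMixin (dual C A).
HB.instance Definition _ (C : numFieldType) (A : topologicalZmodType) :=
  gen_choiceMixin (dual C A).
HB.instance Definition _ (C : numFieldType) (A : topologicalZmodType) :=
  Topological.copy (dual C A) (initial_topology
    (@dual_fun C A : dual C A -> {compact-open, A -> circle C})).

Section Dual.
Context {C : numFieldType} {A : topologicalZmodType}.
Implicit Types x y z : dual C A.

Lemma dual_eqP x y : x =1 y -> x = y.
Proof.
case: x y => [f cf mf] [g cg mg] /= /funext fg; rewrite {}fg in cf mf *.
by rewrite (Prop_irrelevance cf cg) (Prop_irrelevance mf mg).
Qed.

Fact dual_zero_continuous : continuous (fun _ : A => 0 : circle C).
Proof. exact: cst_continuous. Qed.

Fact dual_zeroD : {morph (fun _ : A => 0 : circle C) : a b / a + b}.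
Proof. by move=> a b; rewrite addr0. Qed.

Definition dual_zero : dual C A := Dual dual_zero_continuous dual_zeroD.

Fact dual_add_continuous x y : continuous (fun a => x a + y a).
Proof.
move=> a; apply: (@continuous_comp _ _ _ (fun a => (x a, y a))
  (fun zw : circle C * circle C => zw.1 + zw.2)); last exact: add_continuous.
exact: (cvg_pair (@dual_continuous _ _ x a) (@dual_continuous _ _ y a)).
Qed.

Fact dual_addD x y : {morph (fun a => x a + y a) : a b / a + b}.
Proof. by move=> a b; rewrite !dualD addrACA. Qed.

Definition dual_add x y : dual C A :=
  Dual (@dual_add_continuous x y) (@dual_addD x y).

Fact dual_opp_continuous x : continuous (fun a => - x a).
Proof.
move=> a; apply: continuous_comp; first exact: dual_continuous.
exact: opp_continuous.
Qed.

Fact dual_oppD x : {morph (fun a => - x a) : a b / a + b}.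
Proof. by move=> a b; rewrite dualD opprD. Qed.

Definition dual_opp x : dual C A :=
  Dual (@dual_opp_continuous x) (@dual_oppD x).

Fact dual_addA : associative dual_add.
Proof. by move=> x y z; apply: dual_eqP => a; exact: addrA. Qed.

Fact dual_addC : commutative dual_add.
Proof. by move=> x y; apply: dual_eqP => a; exact: addrC. Qed.

Fact dual_add0 : left_id dual_zero dual_add.
Proof. by move=> x; apply: dual_eqP => a; exact: add0r. Qed.

Fact dual_addN : left_inverse dual_zero dual_opp dual_add.
Proof. by move=> x; apply: dual_eqP => a; exact: addNr. Qed.

HB.instance Definition _ := GRing.isZmodule.Build (dual C A)
  dual_addA dual_addC dual_add0 dual_addN.

End Dual.

(* The transpose [x |-> x \o f] of a continuous endomorphism of [A]. *)
Section DualMap.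
Context {C : numFieldType} {A : topologicalZmodType}.
Variables (f : A -> A) (cf : continuous f) (fD : {morph f : a b / a + b}).

Fact dual_map_continuous (x : dual C A) : continuous (x \o f).
Proof. by move=> a; apply: continuous_comp; [exact: cf | exact: dual_continuous]. Qed.

Fact dual_mapD (x : dual C A) : {morph x \o f : a b / a + b}.
Proof. by move=> a b; rewrite /= fD dualD. Qed.

Definition dual_map (x : dual C A) : dual C A :=
  Dual (@dual_map_continuous x) (@dual_mapD x).

End DualMap.

Definition expansive (X : PreTopologicalZmodule.type) (I : Type)
    (alpha : I -> X -> X) (G : set I) : Prop :=
  exists2 N : set X, nbhs 0 N & \bigcap_(g in G) (alpha g @` N) = [set 0].

(* Additive groups with the discrete topology. *)
HB.instance Definition _ (A : zmodType) :=
  GRing.Zmodule.on (discrete_topology A).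

Section Discrete.
Variable A : zmodType.
Local Notation D := (discrete_topology A).

Lemma discrete_continuous (T : topologicalType) (f : D -> T) : continuous f.
Proof.
move=> a U Ufa; apply/(filterS _ (discrete_set1 a)) => _ ->.
exact: nbhs_singleton Ufa.
Qed.

Fact discrete_add_continuous : continuous (fun ab : D * D => ab.1 + ab.2).
Proof.
move=> [a b] U /nbhs_singleton Uab.
exists ([set a], [set b]); first by split; exact: discrete_set1.
by move=> [a' b'] [/= -> ->].
Qed.

Fact discrete_opp_continuous : continuous (-%R : D -> D).
Proof. exact: discrete_continuous. Qed.

HB.instance Definition _ := PreTopologicalNmodule_isTopologicalNmodule.Build
  D discrete_add_continuous.
HB.instance Definition _ := TopologicalNmodule_isTopologicalZmodule.Build
  D discrete_opp_continuous.

End Discrete.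

(* For [g : M], the endomorphism of the dual of the discrete group [M] which is
   dual to multiplication by [g]; an automorphism when [g] is a unit. *)
Definition induced_action (R : realType) (M : idomainType) (g : M) :
    dual R[i] (discrete_topology M) -> dual R[i] (discrete_topology M) :=
  @dual_map R[i] (discrete_topology M) ( *%R g)
    (@discrete_continuous M (discrete_topology M) ( *%R g)) (mulrDr g).

(* The smallest subring containing a given set. *)
Definition gen_subring (R : nzRingType) (A : {pred R}) : {pred R} :=
  fun x => `[< forall S : {pred R},
    GRing.subring_closed S -> {subset A <= S} -> x \in S >].

Fact gen_subring_closed (R : nzRingType) (A : {pred R}) :
  GRing.subring_closed (gen_subring A).
Proof.
split=> [|x y /asboolP hx /asboolP hy|x y /asboolP hx /asboolP hy].
- by apply/asboolP => S [].
- by apply/asboolP => S hS AS; case: (hS) => _ SB _; apply: SB; [exact: hx | exact: hy].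
- by apply/asboolP => S hS AS; case: (hS) => _ _ SM; apply: SM; [exact: hx | exact: hy].
Qed.

HB.instance Definition _ (R : nzRingType) (A : {pred R}) :=
  GRing.isSubringClosed.Build R (gen_subring A) (gen_subring_closed A).

(* [gen_subring A] as a ring in its own right. *)
Record gen_subring_of (M : comNzRingType) (A : {pred M}) := GenSubring {
  gen_subring_val :> M;
  gen_subringP : gen_subring_val \in gen_subring A }.

HB.instance Definition _ (M : comNzRingType) (A : {pred M}) :=
  [isSub for @gen_subring_val M A].
HB.instance Definition _ (M : comNzRingType) (A : {pred M}) :=
  [Choice of gen_subring_of A by <:].
HB.instance Definition _ (M : comNzRingType) (A : {pred M}) :=
  [SubChoice_isSubComNzRing of gen_subring_of A by <:].

Definition unit_subgroup (M : idomainType) (G : {pred M}) : Prop :=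
  {subset G <= GRing.unit} /\ GRing.divr_closed G.

(* The image of [Z[G]] in [M] is the subring generated by [G], so the
   [Z[G]]-subalgebra of [M] generated by [s] is the smallest subring containing
   that image and [s]. *)
Definition fin_gen_algebra (M : idomainType) (G : {pred M}) : Prop :=
  exists s : seq M,
    gen_subring [predU gen_subring G & mem s] =i predT.

(** Maps to [H] extended by a formal infinite value: [None] is infinity. *)

(* [v_phi a = ln |phi a|]; [complex.Re] only converts the norm, which is a
   nonnegative real element of [R[i]], to an element of [R]. *)
Definition log_map (R : realType) (A : nzRingType) (phi : A -> R[i]) (a : A) :
    option R :=
  if phi a == 0 then None else Some (ln (complex.Re `|phi a|)).

Definition log_maps (R : realType) (A : nzRingType) : set (A -> option R) :=
  [set v | exists phi : {rmorphism A -> R[i]}, v = log_map phi].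

(* [porderZmodType] is an abelian group with an unrelated partial order. *)
Definition ordered_group (H : porderZmodType) : Prop :=
  total (<=%R : rel H) /\ (forall z x y : H, x <= y -> x + z <= y + z).

Section Valuation.
Context {H : porderZmodType}.
Implicit Types a b : option H.

Definition vadd a b : option H :=
  if (a, b) is (Some x, Some y) then Some (x + y) else None.

Definition vle a b : bool :=
  match a, b with
  | _, None => true
  | None, Some _ => false
  | Some x, Some y => x <= y
  end.

Definition vmin a b : option H := if vle a b then a else b.

Definition is_valuation (K : fieldType) (v : K -> option H) : Prop :=
  [/\ forall x, v x = None <-> x = 0,
      forall x y, v (x * y) = vadd (v x) (v y)
    & forall x y, vle (vmin (v x) (v y)) (v (x + y))].

Definition valuation_ring (K : fieldType) (v : K -> option H) : {pred K} :=
  fun x => vle (Some 0) (v x).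

End Valuation.

(* [V] is a valuation ring of [K] containing [A]. *)
Definition Zar (K : fieldType) (A : set K) (V : {pred K}) : Prop :=
  [/\ GRing.subring_closed V,
      forall x, x != 0 -> x \in V \/ x^-1 \in V
    & forall x, A x -> x \in V].

(* The prime subring: a copy of [Z] in characteristic 0, of [F_p] in
   characteristic p. *)
Definition prime_subring (K : fieldType) : set K :=
  range (fun n : int => n%:~R : K).

Definition ZarC (M : idomainType) (V : {pred {fraction M}}) : Prop :=
  Zar (@prime_subring {fraction M}) V /\ ~ Zar (range (@FracField.tofrac M)) V.

(* The valuations of the fraction field of [M], with values in [H], whose
   valuation ring does not contain [M]. *)
Definition valuations_ZarC (M : idomainType) (H : porderZmodType) :
    set ({fraction M} -> option H) :=
  [set v | is_valuation v /\ ZarC (valuation_ring v)].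

(* Main.v *)
Require Import Defs.
From HB Require Import structures.
From mathcomp Require Import all_boot all_order all_algebra.
From mathcomp Require Import all_classical all_reals all_analysis.
From mathcomp Require Import complex ring lra.
From mathcomp Require cyclic separable cyclotomic.

Set Implicit Arguments.
Unset Strict Implicit.
Unset Printing Implicit Defensive.

Import Order.TTheory GRing.Theory Num.Theory.
Import numFieldNormedType.Exports.

Local Open Scope classical_set_scope.
Local Open Scope ring_scope.

(** Write [A = M_G].  A neighbourhood of 0 in the dual is given by finitely many
    [f in M] and [e > 0], so expansiveness says that for suitable [F] and [e] a
    character [chi] with [|chi (g f) - 1| < e] for all [g in G], [f in F] is
    trivial.  Since characters separate points, [F] then generates the
    [A]-module [M].  A valuation which is trivial on [G] is nonnegative on [A],
    hence on [M]: compare a square [f^2] with [f], for [f in F] of least value.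
    A homomorphism [phi : A -> C] which is unitary on [G] gives a nonzero
    [phi]-linear functional [h] on [M], and the characters [exp (i t Re h)], with
    [t] small, contradict expansiveness.

    Conversely, the condition on valuations makes every element of [M] integral
    over [A] (Chevalley), so that [M] is a finitely generated [A]-module.  If the
    action is not expansive, an ultralimit of rescaled nontrivial characters
    [(chi_k - 1) / c_k] is a nonzero additive functional [h : M -> C] which is
    bounded on orbits.  The group [G] acts isometrically on these functionals, so
    that each [g in G] has approximate eigenvalues on the unit circle, and
    further ultralimits turn these into a joint eigenfunction of all [g in G].
    Its eigenvalues extend to a homomorphism [A -> C] which is unitary on [G]. *)

(** * Complex moduli and ultralimits *)

Section ComplexModulus.
Variable R : realType.
Implicit Types (x y : R[i]) (r : R).

Definition cmod x : R := complex.Re `|x|.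

Lemma cmodE x : `|x| = (cmod x)%:C%C.
Proof. by rewrite /cmod normc_def. Qed.

Lemma cmod_ge0 x : 0 <= cmod x.
Proof. by rewrite -lecR -cmodE normr_ge0. Qed.

Lemma cmodM x y : cmod (x * y) = cmod x * cmod y.
Proof. by apply: complexI; rewrite rmorphM /= -!cmodE normrM. Qed.

Lemma cmodN x : cmod (- x) = cmod x.
Proof. by rewrite /cmod normrN. Qed.

Lemma cmod1 : cmod 1 = 1.
Proof. by rewrite /cmod normr1. Qed.

Lemma cmod0 : cmod 0 = 0.
Proof. by rewrite /cmod normr0. Qed.

Lemma cmodX x n : cmod (x ^+ n) = cmod x ^+ n.
Proof. by elim: n => [|n IH]; rewrite ?expr0 ?cmod1// !exprS cmodM IH. Qed.

Lemma cmodV x : cmod x^-1 = (cmod x)^-1.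
Proof. by apply: complexI; rewrite fmorphV /= -!cmodE normfV. Qed.

Lemma cmodD x y : cmod (x + y) <= cmod x + cmod y.
Proof. by rewrite -lecR rmorphD /= -!cmodE ler_normD. Qed.

Lemma cmod_eq0 x : (cmod x == 0) = (x == 0).
Proof. by rewrite -(inj_eq (@complexI R)) -cmodE normr_eq0. Qed.

Lemma cmod_gt0 x : (0 < cmod x) = (x != 0).
Proof. by rewrite lt_def cmod_ge0 andbT cmod_eq0. Qed.

Lemma cmod_real r : cmod r%:C%C = `|r|.
Proof. by rewrite /cmod normc_def /= expr0n addr0 sqrtr_sqr. Qed.

Lemma cmod_nat n : cmod n%:R = n%:R.
Proof.
by rewrite -[n%:R](rmorph_nat (real_complex R)) cmod_real ger0_norm ?ler0n.
Qed.

Lemma Re_le_cmod x : `|complex.Re x| <= cmod x.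
Proof. by rewrite -lecR -cmodE; exact: normc_ge_Re. Qed.

Lemma Im_le_cmod x : `|complex.Im x| <= cmod x.
Proof.
rewrite -normrN -ReiNIm; apply: (le_trans (Re_le_cmod _)).
by rewrite cmodM [X in _ * X](_ : _ = 1) ?mulr1 // /cmod normc_def /=
  expr0n expr1n add0r sqrtr1.
Qed.

Lemma cmod_sqr x : cmod x ^+ 2 = complex.Re x ^+ 2 + complex.Im x ^+ 2.
Proof.
by rewrite /cmod normc_def /= sqr_sqrtr // addr_ge0 // sqr_ge0.
Qed.

Lemma ReD x y : complex.Re (x + y) = complex.Re x + complex.Re y.
Proof. by case: x y => ? ? []. Qed.

Lemma ImD x y : complex.Im (x + y) = complex.Im x + complex.Im y.
Proof. by case: x y => ? ? []. Qed.

Lemma ReM x y : complex.Re (x * y) =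
  complex.Re x * complex.Re y - complex.Im x * complex.Im y.
Proof. by case: x y => ? ? []. Qed.

Lemma ImM x y : complex.Im (x * y) =
  complex.Re x * complex.Im y + complex.Im x * complex.Re y.
Proof. by case: x y => ? ? []. Qed.

End ComplexModulus.

(** * Limits of bounded sequences along a free ultrafilter *)

Section Ultralimit.
Variable R : realType.
Variables (U : set_system nat) (UU : UltraFilter U) (UN : \oo `<=` U).
Implicit Types (u v : nat -> R[i]) (s t : nat -> R).

Let properU : ProperFilter U := @ultra_proper _ _ UU.
#[local] Existing Instance properU.

Definition ulim s : R := lim (s @ U).

(** The image of an ultrafilter is an ultrafilter, and in the compact interval [[-B, B]] every
    ultrafilter converges. *)
Lemma cvg_ulim s B : (forall n, `|s n| <= B) -> s @ U --> ulim s.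
Proof.
move=> sB.
have := @segment_compact R (- B) B; rewrite compact_ultra => /(_ (s @ U)).
have US : UltraFilter (s @ U).
  split; first exact: fmap_proper_filter.
  move=> G GF sub; apply/seteqP; split=> // A GA.
  case: (in_ultra_setVsetC (s @^-1` A) UU) => // H.
  have /sub H' : (s @ U) (~` A) by [].
  have /filter_ex[x []] // : G (~` A `&` A) by exact: filterI.
move=> /(_ US) []; first by apply: (@filterE _ U _ (s @^-1` _)) => n /=;
  rewrite in_itv /= -ler_norml.
by move=> p [_ hp]; rewrite /ulim (cvg_lim _ hp).
Qed.

Lemma ulim_uniq s l : s @ U --> l -> ulim s = l.
Proof. by move=> sl; apply: cvg_lim. Qed.

Lemma cvg_ext s t (l l' : R) : (forall n, s n = t n) -> l = l' ->
  s @ U --> l -> t @ U --> l'.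
Proof. by move=> /funext -> ->. Qed.

Definition bounded_seq u := exists B, forall n, cmod (u n) <= B.

Definition culim u : R[i] :=
  (ulim (fun n => complex.Re (u n)) +i* ulim (fun n => complex.Im (u n)))%C.

Lemma cvg_ulimRe u : bounded_seq u ->
  (fun n => complex.Re (u n)) @ U --> complex.Re (culim u).
Proof.
by case=> B uB; apply: (@cvg_ulim _ B) => n; exact: le_trans (Re_le_cmod _) _.
Qed.

Lemma cvg_ulimIm u : bounded_seq u ->
  (fun n => complex.Im (u n)) @ U --> complex.Im (culim u).
Proof.
by case=> B uB; apply: (@cvg_ulim _ B) => n; exact: le_trans (Im_le_cmod _) _.
Qed.

Lemma culim_uniq u l : (fun n => complex.Re (u n)) @ U --> complex.Re l ->
  (fun n => complex.Im (u n)) @ U --> complex.Im l -> culim u = l.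
Proof.
by case: l => a b /= /ulim_uniq ha /ulim_uniq hb; rewrite /culim ha hb.
Qed.

Lemma culimD u v : bounded_seq u -> bounded_seq v ->
  culim (fun n => u n + v n) = culim u + culim v.
Proof.
move=> bu bv; apply: culim_uniq.
  apply: (cvg_ext _ _ (cvgD (cvg_ulimRe bu) (cvg_ulimRe bv))) => [n|]; exact: esym (ReD _ _).
apply: (cvg_ext _ _ (cvgD (cvg_ulimIm bu) (cvg_ulimIm bv))) => [n|]; exact: esym (ImD _ _).
Qed.

Lemma culimM u v : bounded_seq u -> bounded_seq v ->
  culim (fun n => u n * v n) = culim u * culim v.
Proof.
move=> bu bv; apply: culim_uniq.
  apply: (cvg_ext _ _ (cvgB (cvgM (cvg_ulimRe bu) (cvg_ulimRe bv))
    (cvgM (cvg_ulimIm bu) (cvg_ulimIm bv)))) => [n|]; exact: esym (ReM _ _).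
apply: (cvg_ext _ _ (cvgD (cvgM (cvg_ulimRe bu) (cvg_ulimIm bv))
  (cvgM (cvg_ulimIm bu) (cvg_ulimRe bv)))) => [n|]; exact: esym (ImM _ _).
Qed.

Lemma culim_cst (c : R[i]) : culim (fun=> c) = c.
Proof. by apply: culim_uniq; exact: cvg_cst. Qed.

Lemma bounded_seq_cst (c : R[i]) : bounded_seq (fun=> c).
Proof. by exists (cmod c). Qed.

Lemma bounded_seqD u v : bounded_seq u -> bounded_seq v ->
  bounded_seq (fun n => u n + v n).
Proof.
move=> [B uB] [D vD]; exists (B + D) => n.
by apply: (le_trans (cmodD _ _)); exact: lerD.
Qed.

Lemma bounded_seqM u v : bounded_seq u -> bounded_seq v ->
  bounded_seq (fun n => u n * v n).
Proof.
move=> [B uB] [D vD]; exists (B * D) => n.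
by rewrite cmodM; apply: ler_pM => //; exact: cmod_ge0.
Qed.

(** [U] refines the filter at infinity, so [B / (n + 1)] tends to 0 along [U] and squeezes both the
    real and the imaginary part. *)
Lemma culim0 u B : (forall n, cmod (u n) <= B / n.+1%:R) -> culim u = 0.
Proof.
move=> uB.
have c0 : (fun n : nat => B / n.+1%:R) @ U --> (0 : R).
  apply: (cvg_trans _ (_ : (fun n : nat => B / n.+1%:R) @ \oo --> (0 : R))).
    by move=> A; exact: UN.
  rewrite -[0](mulr0 B); apply: cvgM; first exact: cvg_cst.
  exact: cvg_harmonic.
have sq (f : R[i] -> R) : (forall x, `|f x| <= cmod x) ->
    (fun n => f (u n)) @ U --> (0 : R).
  move=> fle; apply/norm_cvg0P.
  apply: (@squeeze_cvgr _ _ _ _ (fun=> 0) (fun n : nat => B / n.+1%:R)) => //;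
    last exact: cvg_cst.
  by apply: filterE => n; rewrite normr_ge0 /=; exact: le_trans (fle _) (uB n).
by apply: culim_uniq; apply: sq => x; [exact: Re_le_cmod | exact: Im_le_cmod].
Qed.

Lemma cvg_ulim_cmod u : bounded_seq u ->
  (fun n => cmod (u n)) @ U --> cmod (culim u).
Proof.
move=> bu; have h (x : R[i]) : cmod x = Num.sqrt (complex.Re x ^+ 2 + complex.Im x ^+ 2).
  by rewrite -cmod_sqr sqrtr_sqr ger0_norm // cmod_ge0.
rewrite h; under eq_fun do rewrite h.
apply: (continuous_cvg _ (@sqrt_continuous R _)).
by apply: cvgD; rewrite expr2; apply: cvgM;
  [exact: cvg_ulimRe|exact: cvg_ulimRe|exact: cvg_ulimIm|exact: cvg_ulimIm].
Qed.

(** Lets a lower bound survive the limit although the witness [f] varies with [n]. If every limit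
    were 0, the finitely many sets where [cmod (u f n) < c] would all lie in [U], and an index in
    their intersection violates the bound. *)
Lemma culim_neq0 (T : eqType) (F : seq T) (u : T -> nat -> R[i]) (c : R) :
  0 < c -> (forall f, bounded_seq (u f)) ->
  (forall n, exists2 f, f \in F & c <= cmod (u f n)) ->
  exists2 f, f \in F & culim (u f) != 0.
Proof.
move=> c0 bu uc; apply: contrapT => H.
have cv f : f \in F -> U [set n | cmod (u f n) < c].
  move=> fF; have := cvg_ulim_cmod (bu f).
  have -> : culim (u f) = 0.
    by apply/eqP/negPn/negP => nz; apply: H; exists f.
  by rewrite cmod0 => /cvgr_lt; exact.
have : U [set n | {in F, forall f, cmod (u f n) < c}].
  elim: F {uc H} cv => [|f F IH] cv; first by apply: filterE => n /= f; rewrite in_nil.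
  have H1 := cv f (mem_head _ _).
  have /IH H2 g : g \in F -> U [set n | cmod (u g n) < c].
    by move=> gF; apply: cv; rewrite in_cons gF orbT.
  apply: filterS2 H1 H2 => n /= h1 h2 g; rewrite in_cons => /orP[/eqP -> //|].
  exact: h2.
move=> /filter_ex[n /= nF]; have [f fF] := uc n.
by rewrite leNgt nF.
Qed.

End Ultralimit.

(** * Approximate eigenvalues *)

(** [X^n - 1] splits and is separable in characteristic 0, so it has [n] distinct roots, and a
    finite group of roots of unity is cyclic. *)
Lemma primitive_root_exists (C : numClosedFieldType) n :
  (0 < n)%N -> {z : C | n.-primitive_root z}.
Proof.
pose p : {poly C} := 'X^n - 1; have [r Dp] := closed_field_poly_normal p.
move=> n_gt0; apply/sigW; rewrite (monicP _) ?monicXnsubC // scale1r in Dp.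
have rn1: all n.-unity_root r by apply/allP=> z; rewrite -root_prod_XsubC -Dp.
have sz_r: (n < (size r).+1)%N.
  by rewrite -(size_prod_XsubC r id) -Dp size_XnsubC.
have [|z] := hasP (cyclic.has_prim_root n_gt0 rn1 _ sz_r); last by exists z.
by rewrite -separable.separable_prod_XsubC -Dp cyclotomic.separable_Xn_sub_1 // pnatr_eq0 -lt0n.
Qed.

Lemma sum_primitive_root_expr (F : fieldType) (n : nat) (z : F) (k : nat) :
  n.-primitive_root z -> (0 < k < n)%N -> \sum_(i < n) (z ^+ i) ^+ k = 0.
Proof.
move=> pz /andP[k0 kn]; have zk1 : z ^+ k - 1 != 0.
  rewrite subr_eq0 -(prim_order_dvd pz); apply/negP => /dvdn_leq.
  by rewrite k0 leqNgt kn => /(_ isT).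
apply: (mulfI zk1); rewrite mulr0.
have -> : \sum_(i < n) (z ^+ i) ^+ k = \sum_(i < n) (z ^+ k) ^+ i.
  by apply: eq_bigr => i _; rewrite -!exprM mulnC.
by rewrite -subrX1 -exprM mulnC exprM (prim_expr_order pz) expr1n subrr.
Qed.

(** Denominator-free form of [1 / (X - a) - 1 / (X - b) = (a - b) / ((X - a) (X - b))], multiplied
    by [P Q]. *)
Lemma cofactor_cross (C : comPzRingType) (X a b A B P Q : C) :
  (X - a) * A = P -> (X - b) * B = Q ->
  (X - a) * ((X - b) * (A * Q - B * P)) = (a - b) * (P * Q).
Proof. by move=> <- <-; ring. Qed.

Section ApproximateEigenvalue.
(** In the application [q p] is the norm of [p(T) h], where [T] translates functionals by a group
    element; [qX] records that [T] is isometric, and [q1] that [h] is nonzero. *)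
Variables (R : realType) (q : {poly R[i]} -> R).
Hypothesis qD : forall p r, q (p + r) <= q p + q r.
Hypothesis qZ : forall c p, q (c *: p) = cmod c * q p.
Hypothesis qX : forall p, q ('X * p) = q p.
Hypothesis q1 : 0 < q 1.


Lemma seminorm_ge0 p : 0 <= q p.
Proof.
have := qD p (-1 *: p); rewrite qZ cmodN cmod1 mul1r scaleN1r subrr.
by have := qZ 0 p; rewrite scale0r cmod0 mul0r => -> ?; lra.
Qed.

Lemma seminormMXn n p : q ('X^n * p) = q p.
Proof. by elim: n => [|n IH]; rewrite ?expr0 ?mul1r// exprS -mulrA qX. Qed.

Lemma seminorm_sum (I : finType) (F : I -> {poly R[i]}) :
  q (\sum_i F i) <= \sum_i q (F i).
Proof.
apply: (big_ind2 (fun x y => q x <= y)) => //.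
  by rewrite -(scale0r 0) qZ cmod0 mul0r.
by move=> x a y b xa yb; apply: (le_trans (qD _ _)); exact: lerD.
Qed.

Lemma seminorm_Xn_sub n (c : R[i]) p : q (('X^n - c%:P) * p) <= (1 + cmod c) * q p.
Proof.
rewrite mulrBl; apply: (le_trans (qD _ _)).
by rewrite -scaleN1r qZ mul_polyC qZ cmodN cmod1 mul1r seminormMXn mulrDl mul1r.
Qed.

(** The quotient of [X^K - c^K] by [X - c]. *)
Let cofactor (K : nat) (c : R[i]) : {poly R[i]} :=
  \sum_(k < K) 'X^(K.-1 - k) * c%:P ^+ k.

Let cofactorE K c : ('X - c%:P) * cofactor K c = 'X^K - (c ^+ K)%:P.
Proof. by rewrite -subrXX rmorphXn. Qed.

(** The powers [z^(i k)] with [0 < k < K] sum to 0, so only the term [k = 0] survives. The result is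
    the derivative of [X^K - t^K], as in a logarithmic derivative. *)
Let sum_cofactor K (z t : R[i]) : (0 < K)%N -> K.-primitive_root z ->
  \sum_(i < K) cofactor K (t * z ^+ i) = K%:R *: 'X^(K.-1).
Proof.
move=> K0 pz; rewrite exchange_big /=.
case: K K0 pz => // K _ pz; rewrite big_ord_recl [X in _ + X]big1 => [|k _].
  rewrite addr0 (eq_bigr (fun=> 'X^K)) => [|i _]; last by rewrite /= subn0 expr0 mulr1.
  by rewrite sumr_const card_ord scaler_nat.
rewrite -mulr_sumr.
under eq_bigr do rewrite -rmorphXn /= exprMn.
rewrite -rmorph_sum /= -mulr_sumr (sum_primitive_root_expr pz).
  by rewrite mulr0 rmorph0 mulr0.
by rewrite /= /bump /= add1n ltnS ltn_ord.
Qed.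

(* If every [X - l] with [|l| = 1] were bounded below for [q], then so would be
   [X - t l] with [t] near 1.  Comparing the logarithmic derivatives of
   [X^K - r^K] and [X^K - s^K] for [s < 1 < r] gives a contradiction for large
   [K]. *)
Lemma approximate_eigenvalue (e : R) : 0 < e ->
  exists l p, cmod l = 1 /\ q (('X - l%:P) * p) < e * q p.
Proof.
move=> e0; apply: contrapT => H.
(* The cap at 1 gives [h <= d / 2] and keeps [s = 1 - h] positive. *)
pose d := Num.min e 1; have d0 : 0 < d by rewrite lt_min e0 ltr01.
have d1 : d <= 1 by rewrite ge_min lexx orbT.
have lbd l p : cmod l = 1 -> d * q p <= q (('X - l%:P) * p).
  move=> l1; apply: (@le_trans _ _ (e * q p)).
    by apply: ler_wpM2r; [exact: seminorm_ge0 | rewrite ge_min lexx].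
  by rewrite leNgt; apply/negP => ?; apply: H; exists l, p.
(* Chosen so that [2 * h] divided by [(d / 2) ^+ 2] is [1 / 8]. *)
pose h := d ^+ 2 / 64.
have h0 : 0 < h by rewrite /h divr_gt0 // exprn_gt0.
have hd : h <= d / 2 by rewrite /h; nra.
(* Moving the root radially by at most [h] changes the value by at most [h * q p], so half of the
   lower bound [d] survives. *)
have lbt t l p : cmod l = 1 -> `|t - 1| <= h ->
    d / 2 * q p <= q (('X - (t%:C%C * l)%:P) * p).
  move=> l1 t1; have q0 := seminorm_ge0 p.
  have := lbd l p l1.
  have -> : ('X - l%:P) * p = ('X - (t%:C%C * l)%:P) * p + ((t - 1)%:C%C * l) *: p.
    rewrite -mul_polyC -mulrDl; congr (_ * _).
    by rewrite rmorphB /= rmorph1 mulrBl mul1r polyCB; ring.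
  move=> /le_trans /(_ (qD _ _)); rewrite qZ cmodM l1 mulr1 cmod_real.
  have : `|t - 1| * q p <= h * q p by exact: ler_wpM2r.
  nra.
pose r := 1 + h; pose s := 1 - h.
have s0 : 0 < s by rewrite /s; nra.
have r0 : 0 < r by rewrite /r; lra.
have r1 : `|r - 1| <= h by rewrite /r addrAC subrr add0r ger0_norm // ltW.
have s1 : `|s - 1| <= h by rewrite /s addrAC subrr add0r normrN ger0_norm // ltW.
have bern n : 1 + n%:R * h <= r ^+ n.
  elim: n => [|n IH]; first by rewrite mul0r addr0 expr0.
  rewrite exprS -natr1; have := ler_wpM2l (ltW r0) IH; rewrite /r.
  have : 0 <= n%:R * h * h by rewrite !mulr_ge0 // ltW.
  nra.
(* Bernoulli's inequality makes [r ^+ K] at least 4. Since [s * r = 1 - h ^+ 2], it follows that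
   [s ^+ K] is at most [1 / 4]. *)
have [K K0 aK] : exists2 K, (0 < K)%N & 4 <= r ^+ K.
  exists (Num.truncn (3 / h)).+1 => //; apply: le_trans (bern _).
  have := truncnS_gt (3 / h); rewrite ltr_pdivrMr //; lra.
have b0 : 0 < s ^+ K by rewrite exprn_gt0.
have bK : s ^+ K * r ^+ K <= 1.
  by rewrite -exprMn; apply: exprn_ile1; rewrite ?mulr_ge0 ?ltW // /s /r; nra.
have [z pz] := @primitive_root_exists R[i] K K0.
have zK i : cmod (z ^+ i) = 1.
  have /eqP : cmod z ^+ K = 1 by rewrite -cmodX (prim_expr_order pz) cmod1.
  rewrite pexpr_eq1 ?cmod_ge0 // => /eqP z1.
  by rewrite cmodX z1 expr1n.
pose P t : {poly R[i]} := 'X^K - (t%:C%C ^+ K)%:P.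
pose A t (i : 'I_K) := cofactor K (t%:C%C * z ^+ i).
have PA t (i : 'I_K) : ('X - (t%:C%C * z ^+ i)%:P) * A t i = P t.
  rewrite cofactorE exprMn -[(z ^+ i) ^+ K]exprM mulnC exprM.
  by rewrite (prim_expr_order pz) expr1n mulr1.
(* [D i] is [P r * P s] times the difference of [1 / (X - r z^i)] and [1 / (X - s z^i)]. Summed over
   [i] it becomes [K X^(K-1) (P s - P r)], in which [P s - P r] is a constant. *)
pose D i := A r i * P s - A s i * P r.
have SA t : \sum_i A t i = K%:R *: 'X^(K.-1) by exact: sum_cofactor.
have DA : \sum_i D i = \sum_i A r i * P s - \sum_i A s i * P r by exact: sumrB.
have PB : P s - P r = (r%:C%C ^+ K - s%:C%C ^+ K)%:P.
  by rewrite /P polyCB; ring.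
have qP t p : 0 < t -> q (P t * p) <= (1 + t ^+ K) * q p.
  move=> t0; have := seminorm_Xn_sub K (t%:C%C ^+ K) p.
  by rewrite cmodX cmod_real (ger0_norm (ltW t0)).
clearbody A P.
have rsC : (r ^+ K - s ^+ K)%:C%C = r%:C%C ^+ K - s%:C%C ^+ K.
  by rewrite (rmorphB (real_complex R)) !(rmorphXn (real_complex R)).
have sumD : \sum_i D i = (K%:R * (r ^+ K - s ^+ K)%:C%C) *: 'X^(K.-1).
  rewrite DA -!mulr_suml !SA -!scalerAl -scalerBr -mulrBr PB -rsC.
  by rewrite -scalerA; congr (_ *: _); rewrite mulrC mul_polyC.
(* The lower bounds at [s] and at [r] are applied in turn. The product of both linear factors with
   [D i] collapses to [(r - s) z^i P r P s], which is small because [r - s = 2 h]. *)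
have qD_le i : d / 2 * (d / 2 * q (D i)) <=
    2 * h * ((1 + r ^+ K) * ((1 + s ^+ K) * q 1)).
  have H1 := lbt s (z ^+ i) (D i) (zK i) s1.
  have H2 := lbt r (z ^+ i) (('X - (s%:C%C * z ^+ i)%:P) * D i) (zK i) r1.
  apply: le_trans (le_trans H2 _); first by apply: ler_wpM2l => //; lra.
  have -> : ('X - (r%:C%C * z ^+ i)%:P) * (('X - (s%:C%C * z ^+ i)%:P) * D i) =
    ((r - s)%:C%C * z ^+ i) *: (P r * (P s * 1)).
    have rsz : ((r - s)%:C%C * z ^+ i)%:P =
        (r%:C%C * z ^+ i)%:P - (s%:C%C * z ^+ i)%:P.
      by rewrite -polyCB -mulrBl -rmorphB.
    rewrite -mul_polyC mulr1 rsz.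
    exact: cofactor_cross (PA r i) (PA s i).
  rewrite qZ cmodM zK mulr1 cmod_real.
  have -> : `|r - s| = 2 * h.
    by rewrite ger0_norm /r /s; [ring | nra].
  apply: ler_wpM2l; first by rewrite mulr_ge0 // ltW.
  apply: (le_trans (qP _ _ r0)).
  apply: ler_wpM2l; first by rewrite addr_ge0 // ltW // exprn_gt0.
  exact: qP.
have : K%:R * (r ^+ K - s ^+ K) * q 1 <= \sum_i q (D i).
  have := seminorm_sum D; rewrite sumD qZ cmodM cmod_nat cmod_real -(mulr1 'X^_) seminormMXn.
  by rewrite ger0_norm //; nra.
have : \sum_i q (D i) <= \sum_(i < K) (1 / 8) * ((1 + r ^+ K) * ((1 + s ^+ K) * q 1)).
  apply: ler_sum => i _; have := qD_le i.
  rewrite mulrA (_ : d / 2 * (d / 2) = d ^+ 2 / 4); last by field.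
  rewrite (_ : 2 * h = d ^+ 2 / 4 * (1 / 8)); last by rewrite /h; field.
  by rewrite -[in X in _ <= X -> _]mulrA ler_pM2l // divr_gt0 // exprn_gt0.
rewrite sumr_const card_ord -[_ *+ K]mulr_natl => h1 /le_trans /(_ h1).
rewrite -mulrA ler_pM2l ?ltr0n // !mulrA ler_pM2r //.
(* What remains is [a - b <= (1 + a) (1 + b) / 8], which fails for [a >= 4] and [b <= 1 / 4]. *)
move: aK b0 bK; set a := r ^+ K; set b := s ^+ K => aK b0 bK.
have : b <= 1 / 4 by nra.
nra.
Qed.

End ApproximateEigenvalue.

(** * Existence of valuation rings *)

Lemma Zorn_above (T : Type) (Q : set (set T)) (B0 : set T) : Q B0 ->
  (forall F : set (set T), F !=set0 -> F `<=` Q -> total_on F subset ->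
     Q (\bigcup_(X in F) X)) ->
  exists2 B, Q B & B0 `<=` B /\ forall B', Q B' -> B `<=` B' -> B' = B.
Proof.
move=> QB0 Qchain; pose P B := B = set0 \/ (Q B /\ B0 `<=` B).
have [F FP Ftot|B [PB maxB]] := @Zorn_bigcup _ P.
  have [[X [FX X0]]|H] := pselect (exists X, F X /\ X <> set0); last first.
    left; rewrite -subset0 => x [X FX Xx]; apply: H; exists X; split=> // X0.
    by rewrite X0 in Xx.
  right; have [//|[QX BX]] := FP _ FX; split; last first.
    by move=> x Bx; exists X => //; exact: BX.
  have -> : \bigcup_(X in F) X = \bigcup_(X in F `&` Q `&` [set X | B0 `<=` X]) X.
    apply/seteqP; split => x [Y]; last by move=> [[FY _] _] Yx; exists Y.
    by move=> FY Yx; case: (FP _ FY) => [Y0|[QY BY]]; [rewrite Y0 in Yx | exists Y].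
  apply: Qchain; [by exists X | by move=> Y [[]] |].
  by move=> Y Z [[FY _] _] [[FZ _] _]; exact: Ftot.
have [QB BB] : Q B /\ B0 `<=` B.
  case: PB => // B0'; have [B00|B0n0] := pselect (B0 = set0).
    have -> : B = B0 by rewrite B0' B00.
    by split => // ?.
  exfalso; apply: (maxB B0); last by right; split => // ?.
  rewrite B0'; split; first exact: sub0set.
  by rewrite subset0.
exists B => //; split=> // B' QB' BB'; apply: contrapT => ne; apply: (maxB B').
  by split=> // B'B; apply: ne; apply/seteqP.
by right; split=> //; exact: subset_trans BB'.
Qed.

(** * Subrings and the adjunction of an element *)

Section Subrings.
Variable K : comNzRingType.

Definition subring (B : set K) :=
  [/\ B 1, forall x y, B x -> B y -> B (x - y) & forall x y, B x -> B y -> B (x * y)].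

Variables (B : set K) (rB : subring B).

Lemma subring1 : B 1. Proof. by case: rB. Qed.
Lemma subringB x y : B x -> B y -> B (x - y). Proof. by case: rB => _ + _; exact. Qed.
Lemma subringM x y : B x -> B y -> B (x * y). Proof. by case: rB => _ _; exact. Qed.
Lemma subring0 : B 0.
Proof. by rewrite -(subrr 1); apply: subringB; exact: subring1. Qed.
Lemma subringN x : B x -> B (- x).
Proof. by move=> Bx; rewrite -sub0r; apply: subringB => //; exact: subring0. Qed.
Lemma subringD x y : B x -> B y -> B (x + y).
Proof. by move=> Bx By; rewrite -(opprK y); apply: subringB => //; exact: subringN. Qed.
Lemma subring_sum (I : finType) (P : pred I) (F : I -> K) :
  (forall i, P i -> B (F i)) -> B (\sum_(i | P i) F i).
Proof. by move=> BF; apply: big_ind => //; [exact: subring0 | exact: subringD]. Qed.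
Lemma subringX x n : B x -> B (x ^+ n).
Proof.
by move=> Bx; elim: n => [|n IH]; [exact: subring1 | rewrite exprS; exact: subringM].
Qed.

Definition adjoin (y : K) : set K :=
  [set p.[y] | p in [set p : {poly K} | forall i, B p`_i]].

Lemma adjoin_sub y : B `<=` adjoin y.
Proof.
move=> b Bb; exists b%:P; last by rewrite hornerC.
by move=> i; rewrite coefC; case: ifP => // _; exact: subring0.
Qed.

Lemma adjoin_gen y : adjoin y y.
Proof.
exists 'X; last by rewrite hornerX.
by move=> i; rewrite coefX; case: (i == 1%N); [exact: subring1 | exact: subring0].
Qed.

Lemma adjoin_subring y : subring (adjoin y).
Proof.
split; first by apply: adjoin_sub; exact: subring1.
  move=> _ _ [p Bp <-] [r Br <-]; exists (p - r); last by rewrite hornerD hornerN.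
  by move=> i; rewrite coefB; exact: subringB.
move=> _ _ [p Bp <-] [r Br <-]; exists (p * r); last by rewrite hornerM.
by move=> i; rewrite coefM; apply: subring_sum => j _; exact: subringM.
Qed.

End Subrings.

Lemma bigcup_subring (K : comNzRingType) (F : set (set K)) : F !=set0 ->
  (forall X, F X -> subring X) -> total_on F subset -> subring (\bigcup_(X in F) X).
Proof.
move=> [X FX] rF Ft.
have H x y : (\bigcup_(X in F) X) x -> (\bigcup_(X in F) X) y ->
    exists2 Y, F Y & Y x /\ Y y.
  move=> [Y FY Yx] [Z FZ Zy]; case: (Ft _ _ FY FZ) => S.
    by exists Z => //; split=> //; exact: S.
  by exists Y => //; split=> //; exact: S.
split; first by exists X => //; apply: subring1; exact: rF.
  by move=> x y Fx Fy; have [Y FY [Yx Yy]] := H x y Fx Fy; exists Y => //;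
    apply: subringB => //; exact: rF.
by move=> x y Fx Fy; have [Y FY [Yx Yy]] := H x y Fx Fy; exists Y => //;
  apply: subringM => //; exact: rF.
Qed.

(* Chevalley's argument: a subring which is maximal among those that contain
   [x^-1] but not [x] is a valuation ring. *)
Section Chevalley.
Variables (K : fieldType) (x : K) (B : set K).
Hypotheses (rB : subring B) (Bxv : B x^-1) (nBx : ~ B x).
Hypothesis maxB : forall B', subring B' -> ~ B' x -> B `<=` B' -> B' = B.

Let x0 : x != 0.
Proof. by apply/eqP => x0; apply: nBx; rewrite x0; exact: subring0. Qed.

Lemma maximal_adjoin y : ~ B y -> adjoin B y x.
Proof.
move=> nBy; apply: contrapT => nx; apply: nBy.
rewrite -(maxB (adjoin_subring rB y) nx (@adjoin_sub _ _ rB y)).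
exact: adjoin_gen.
Qed.

Lemma one_sub_neq0 b : B b -> 1 - x^-1 * b != 0.
Proof.
move=> Bb; rewrite subr_eq0; apply/eqP => H; apply: nBx.
by rewrite -(mulr1 x) H mulVKf.
Qed.

(** Says that [x^-1] lies in the Jacobson radical of [B]. If [w = 1 - x^-1 b] were not invertible in
    [B], maximality would put [x] in [B[w^-1]], so [x w^N] is in [B] for some [N]. But
    [w^N = 1 - x^-1 c] with [c] in [B], whence [x w^N = x - c] and [x] is in [B]. *)
Lemma maximal_local b : B b -> B (1 - x^-1 * b)^-1.
Proof.
move=> Bb; apply: contrapT => /maximal_adjoin [p Bp].
set w := 1 - x^-1 * b => xE; have w0 : w != 0 by exact: one_sub_neq0.
have Bw : B w by apply: subringB => //; [exact: subring1 | exact: subringM].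
have [c Bc wc] : exists2 c, B c & w ^+ (size p) = 1 - x^-1 * c.
  elim: (size p) => [|n [c Bc IH]].
    by exists 0; [exact: subring0 | rewrite mulr0 subr0 expr0].
  exists (c + b - x^-1 * b * c).
    by apply: subringB => //; [exact: subringD | exact: subringM (subringM _ _ _) _].
  by rewrite exprS IH /w; ring.
apply: nBx; rewrite -(subrK c x); apply: subringD => //.
have -> : x - c = x * w ^+ (size p).
  by rewrite wc mulrBr mulr1 mulrA divff // mul1r.
rewrite -{1}xE horner_coef mulr_suml; apply: subring_sum => // i _.
rewrite -mulrA; apply: subringM => //.
have -> : w ^+ size p = w ^+ (size p - i) * w ^+ i by rewrite -exprD subnK // ltnW.
by rewrite exprVn mulrCA mulVf ?expf_neq0 // mulr1; exact: subringX.
Qed.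

Let combination y n := exists2 b : nat -> K, forall i, B (b i) &
  x = \sum_(i < n.+1) b i * y ^+ i.

Let combination_leq y m n : (m <= n)%N -> combination y m -> combination y n.
Proof.
move=> mn [b Bb xE]; exists (fun i => if (i < m.+1)%N then b i else 0).
  by move=> i; case: ifP => // _; exact: subring0.
rewrite xE (big_ord_widen n.+1 (fun i => b i * y ^+ i)) // big_mkcond.
by apply: eq_bigr => i _; case: ifP => //; rewrite mul0r.
Qed.

(** In [x = c_0 + c_1 y^-1 + ...] the constant term is moved to the left, where [x - c_0] is [x]
    times a unit of [B]. Dividing by it and multiplying by [y^n] expresses the top power of [y] by
    lower ones, which is substituted in the other expression. *)
Let combination_descent y n : y != 0 -> combination y n -> combination y^-1 n ->
  exists2 m, n = m.+1 & combination y m.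
Proof.
move=> y0 [b Bb xb] [c Bc xc].
case: n xb xc => [|n] xb xc.
  by exfalso; apply: nBx; rewrite xb big_ord1 expr0 mulr1.
exists n => //; set w := 1 - x^-1 * c 0%N.
have w0 : w != 0 by exact: one_sub_neq0.
have Bw : B w^-1 by exact: maximal_local.
have yn : y ^+ n.+1 = \sum_(i < n.+1) x^-1 * w^-1 * c (n.+1 - i)%N * y ^+ i.
  have : x * w = \sum_(j < n.+1) c j.+1 * y^-1 ^+ j.+1.
    rewrite mulrBr mulr1 mulrA divff // mul1r {1}xc big_ord_recl expr0 mulr1.
    by rewrite addrAC subrr add0r.
  move=> /(congr1 ( *%R (x^-1 * w^-1 * y ^+ n.+1))).
  rewrite (_ : _ * (x * w) = y ^+ n.+1); last by field; rewrite x0 w0.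
  move=> ->; rewrite (reindex_inj rev_ord_inj) mulr_sumr; apply: eq_bigr => i _.
  have iE : (n.+1 - i = (n - i).+1)%N by rewrite subSn // -ltnS.
  rewrite /= subSS iE.
  have H : y ^+ n.+1 * y^-1 ^+ (n - i).+1 = y ^+ i.
    rewrite -iE exprVn -{1}(subnK (ltnW (ltn_ord i))) addnC exprD.
    by rewrite mulfK // expf_neq0.
  by rewrite -H; ring.
exists (fun i => b i + b n.+1 * (x^-1 * w^-1 * c (n.+1 - i)%N)).
  by move=> i; apply: subringD => //; do !apply: subringM => //.
rewrite {1}xb big_ord_recr /= yn mulr_sumr -big_split /=.
by apply: eq_bigr => i _; rewrite mulrDl !mulrA.
Qed.

(** If both inclusions failed, [x] would be a polynomial over [B] in [y] and also in [y^-1]. The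
    descent lowers the larger of the two degrees, padding the smaller one with zeros; the sum of the
    degrees cannot decrease forever. *)
Lemma maximal_valuation_ring y : y != 0 -> B y \/ B y^-1.
Proof.
move=> y0; apply: contrapT => /not_orP[nBy nByv].
have toc z : ~ B z -> exists n, combination z n.
  move=> /maximal_adjoin[p Bp xE]; exists (size p), (fun i => p`_i) => //.
  by rewrite -xE; apply: horner_coef_wide.
suff : forall k n m y, y != 0 -> combination y n -> combination y^-1 m -> (n + m <= k)%N -> False.
  have [n cn] := toc _ nBy; have [m cm] := toc _ nByv.
  by move=> /(_ (n + m)%N n m y y0 cn cm (leqnn _)).
move=> k; elim: k => [|k IH] n m {nBy nByv y0}y y0 cn cm nmk.
    move: nmk; rewrite leqn0 addn_eq0 => /andP[/eqP n0 /eqP m0].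
    by rewrite n0 in cn; rewrite m0 in cm; have [] := combination_descent y0 cn cm.
  have [mn|/ltnW nm] := leqP m n.
    have [n' nE cn'] := combination_descent y0 cn (combination_leq mn cm).
    by apply: (IH n' m y) => //; rewrite nE in nmk.
  have y0v : y^-1 != 0 by rewrite invr_eq0.
  have cn2 : combination y^-1^-1 m by rewrite invrK; exact: combination_leq nm cn.
  have [m' mE cm'] := combination_descent y0v cm cn2.
  by apply: (IH n m' y) => //; move: nmk; rewrite mE addnS.
Qed.

End Chevalley.

(** Zorn's lemma starts from [A[x^-1]]. A subring above the maximal one still contains [A] and
    [x^-1], so Chevalley's argument applies. *)
Lemma valuation_ring_exists (K : fieldType) (A : set K) (x : K) : subring A ->
  ~ adjoin A x^-1 x -> exists V : set K,
  [/\ subring V, forall y, y != 0 -> V y \/ V y^-1, A `<=` V & ~ V x].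
Proof.
move=> rA nAx.
pose Q B := [/\ subring B, B x^-1, A `<=` B & ~ B x].
have [||B [rB Bxv AB nBx] [_ maxB]] := @Zorn_above _ Q (adjoin A x^-1).
- by split=> //; [exact: adjoin_subring | exact: adjoin_gen | exact: adjoin_sub].
- move=> F F0 FQ Ft; split.
  + by apply: bigcup_subring => // X /FQ[].
  + by case: F0 => X FX; exists X => //; case: (FQ _ FX).
  + by case: F0 => X FX y Ay; exists X => //; case: (FQ _ FX) => _ _ + _; exact.
  + by move=> [X FX Xx]; case: (FQ _ FX).
exists B; split=> // y y0; apply: (maximal_valuation_ring (x := x)) => //.
by move=> B' rB' nB'x BB'; apply: maxB => //; split=> //;
  [exact: BB' | exact: subset_trans BB'].
Qed.

(** * The valuation of a valuation ring *)

Section ValueGroup.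
Variables (K : fieldType) (V : set K).
Hypotheses (rV : subring V) (vV : forall y, y != 0 -> V y \/ V y^-1).

Definition nonzero := {x : K | x != 0}.
HB.instance Definition _ := Choice.on nonzero.

(** The quotient of two related elements is a unit of [V], so that [value_group] below is the
    multiplicative group of [K] modulo the units of [V], written additively. *)
Definition same_value (x y : nonzero) :=
  `[< V (val x / val y) >] && `[< V (val y / val x) >].

Lemma nonzeroP (x : nonzero) : val x != 0. Proof. by case: x. Qed.

Lemma V_div_trans (x y z : nonzero) :
  V (val x / val y) -> V (val y / val z) -> V (val x / val z).
Proof.
move=> xy yz; have -> : val x / val z = (val x / val y) * (val y / val z).
  by rewrite mulrA divfK // nonzeroP.
exact: subringM.
Qed.

Lemma same_value_equiv : equiv_class_of same_value.
Proof.
split=> [x|x y|y x z].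
- by rewrite /same_value divff ?nonzeroP // andbb; apply/asboolP; exact: subring1.
- by rewrite /same_value andbC.
- move=> /andP[/asboolP a /asboolP b] /andP[/asboolP c /asboolP d].
  by apply/andP; split; apply/asboolP; [exact: V_div_trans a c | exact: V_div_trans d b].
Qed.

Canonical same_value_rel := EquivRelPack same_value_equiv.

Definition value_group := {eq_quot same_value_rel}%qT.
HB.instance Definition _ := Choice.on value_group.
HB.instance Definition _ := EqQuotient.on value_group.

Definition value_class (x : nonzero) : value_group := (\pi_value_group x)%qT.
Definition value_repr (a : value_group) : nonzero := repr a.

Lemma value_reprK a : value_class (value_repr a) = a. Proof. exact: reprK. Qed.

Lemma value_class_eq x y : value_class x = value_class y <-> V (val x / val y) /\ V (val y / val x).
Proof.
split; first by move=> /eqmodP /andP[/asboolP ? /asboolP ?].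
by move=> [a b]; apply/eqmodP; apply/andP; split; apply/asboolP.
Qed.

Lemma value_repr_class x : V (val (value_repr (value_class x)) / val x) /\ V (val x / val (value_repr (value_class x))).
Proof. by apply/value_class_eq; exact: value_reprK. Qed.

Definition nz_mul (x y : nonzero) : nonzero :=
  exist _ (val x * val y) (mulf_neq0 (nonzeroP x) (nonzeroP y)).
Definition nz_inv (x : nonzero) : nonzero :=
  exist _ (val x)^-1 (invr_neq0 (nonzeroP x)).
Definition nz_one : nonzero := exist _ 1 (oner_neq0 K).

Definition vg_add a b := value_class (nz_mul (value_repr a) (value_repr b)).
Definition vg_opp a := value_class (nz_inv (value_repr a)).
Definition vg_zero := value_class nz_one.
(** Divisibility in [V] of chosen representatives; [vg_le_mk] shows that the choice does not
    matter. *)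
Definition vg_le a b := `[< V (val (value_repr b) / val (value_repr a)) >].

Lemma vg_add_mk x y : vg_add (value_class x) (value_class y) = value_class (nz_mul x y).
Proof.
have [a b] := value_repr_class x; have [c d] := value_repr_class y.
apply/value_class_eq => /=; have nx := nonzeroP x; have ny := nonzeroP y.
have nx' := nonzeroP (value_repr (value_class x)); have ny' := nonzeroP (value_repr (value_class y)).
split.
  have -> : val (value_repr (value_class x)) * val (value_repr (value_class y)) / (val x * val y) =
    (val (value_repr (value_class x)) / val x) * (val (value_repr (value_class y)) / val y) by field; rewrite nx ny.
  exact: subringM.
have -> : val x * val y / (val (value_repr (value_class x)) * val (value_repr (value_class y))) =
  (val x / val (value_repr (value_class x))) * (val y / val (value_repr (value_class y))) by field; rewrite nx' ny'.
exact: subringM.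
Qed.

Lemma vg_opp_mk x : vg_opp (value_class x) = value_class (nz_inv x).
Proof.
have [a b] := value_repr_class x; apply/value_class_eq => /=.
by rewrite !invrK ![_^-1 * _]mulrC.
Qed.

Lemma vg_le_mk x y : vg_le (value_class x) (value_class y) = `[< V (val y / val x) >].
Proof.
have [a b] := value_repr_class x; have [c d] := value_repr_class y.
apply/asboolP/asboolP => H.
  by apply: V_div_trans d _; apply: V_div_trans H _.
by apply: V_div_trans c _; apply: V_div_trans H _.
Qed.

Lemma value_class_surj a : exists x, a = value_class x.
Proof. by exists (value_repr a); rewrite value_reprK. Qed.

Lemma vg_addA : associative vg_add.
Proof.
move=> a b c; have [x ->] := value_class_surj a; have [y ->] := value_class_surj b.
have [z ->] := value_class_surj c; rewrite !vg_add_mk; congr value_class.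
by apply: val_inj; rewrite /= mulrA.
Qed.

Lemma vg_addC : commutative vg_add.
Proof.
move=> a b; have [x ->] := value_class_surj a; have [y ->] := value_class_surj b.
by rewrite !vg_add_mk; congr value_class; apply: val_inj; rewrite /= mulrC.
Qed.

Lemma vg_add0 : left_id vg_zero vg_add.
Proof.
move=> a; have [x ->] := value_class_surj a; rewrite !vg_add_mk; congr value_class.
by apply: val_inj; rewrite /= mul1r.
Qed.

Lemma vg_addN : left_inverse vg_zero vg_opp vg_add.
Proof.
move=> a; have [x ->] := value_class_surj a; rewrite vg_opp_mk !vg_add_mk; congr value_class.
by apply: val_inj; rewrite /= mulVf // nonzeroP.
Qed.

HB.instance Definition _ := GRing.isZmodule.Build value_group
  vg_addA vg_addC vg_add0 vg_addN.

Lemma vg_le_refl : reflexive vg_le.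
Proof.
by move=> a; apply/asboolP; rewrite divff ?nonzeroP //; exact: subring1.
Qed.

Lemma vg_le_anti : antisymmetric vg_le.
Proof.
move=> a b /andP[/asboolP ab /asboolP ba]; rewrite -(value_reprK a) -(value_reprK b).
by apply/value_class_eq.
Qed.

Lemma vg_le_trans : transitive vg_le.
Proof.
by move=> b a c /asboolP ab /asboolP bc; apply/asboolP; apply: V_div_trans bc ab.
Qed.

HB.instance Definition _ := Order.Le_isPOrder.Build ring_display value_group
  vg_le_refl vg_le_anti vg_le_trans.

Definition vg_val (x : K) : option value_group := omap value_class (insub x).

Lemma vg_val0 : vg_val 0 = None.
Proof. by rewrite /vg_val insubN // negbK. Qed.

Lemma vg_valE x (x0 : x != 0) : vg_val x = Some (value_class (exist _ x x0)).
Proof. by rewrite /vg_val insubT. Qed.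

Lemma value_group_ordered : ordered_group value_group.
Proof.
split=> [a b|a b c].
  have /vV : val (value_repr b) / val (value_repr a) != 0 by rewrite mulf_neq0 ?invr_neq0 ?nonzeroP.
  rewrite invf_div => -[H|H]; apply/orP; [left|right]; exact/asboolP.
have [z ->] := value_class_surj a; have [x ->] := value_class_surj b; have [y ->] := value_class_surj c.
change (vg_le (value_class x) (value_class y) -> vg_le (vg_add (value_class x) (value_class z)) (vg_add (value_class y) (value_class z))).
rewrite !vg_add_mk !vg_le_mk /= => /asboolP H; apply/asboolP.
have zn := nonzeroP z; have xn := nonzeroP x.
have -> // : val y * val z / (val x * val z) = val y / val x.
by field; rewrite zn xn.
Qed.

(** For the inequality on sums, divide by the summand of smaller value: if [y / x] is in [V], so is
    [(x + y) / x = 1 + y / x]. *)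
Lemma vg_val_valuation : is_valuation vg_val.
Proof.
split=> [x|x y|x y].
- split=> [|->]; last exact: vg_val0.
  by have [-> //|x0] := eqVneq x 0; rewrite (vg_valE x0).
- have [->|x0] := eqVneq x 0; first by rewrite mul0r vg_val0.
  have [->|y0] := eqVneq y 0; first by rewrite mulr0 vg_val0; case: vg_val.
  rewrite (vg_valE x0) (vg_valE y0) (vg_valE (mulf_neq0 x0 y0)) /=; congr Some.
  change (value_class (exist _ (x * y) (mulf_neq0 x0 y0)) =
    vg_add (value_class (exist _ x x0)) (value_class (exist _ y y0))).
  by rewrite vg_add_mk; congr value_class; apply: val_inj.
have [->|x0] := eqVneq x 0.
  rewrite add0r vg_val0 /vmin; case: (vg_val y) => //= a; exact: vg_le_refl.
have [->|y0] := eqVneq y 0.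
  rewrite addr0 vg_val0 (vg_valE x0) /vmin /=; exact: vg_le_refl.
have [->|xy0] := eqVneq (x + y) 0.
  by rewrite vg_val0; case: vmin.
rewrite (vg_valE x0) (vg_valE y0) (vg_valE xy0) /vmin /=.
have le_class (z w : nonzero) : (value_class z <= value_class w) = `[< V (val w / val z) >].
  exact: vg_le_mk.
rewrite le_class /=; case: ifPn => /asboolP H /=.
  rewrite le_class /=; apply/asboolP; rewrite mulrDl divff //.
  by apply: subringD => //; exact: subring1.
rewrite le_class /=; apply/asboolP; rewrite mulrDl divff //.
apply: subringD => //; last exact: subring1.
have : y / x != 0 by rewrite mulf_neq0 ?invr_neq0.
by move/vV; rewrite invf_div => -[].
Qed.

Lemma vg_val_ring x : (x \in valuation_ring vg_val) = `[< V x >].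
Proof.
rewrite /in_mem /= /valuation_ring; have [->|x0] := eqVneq x 0.
  by rewrite vg_val0; apply/esym/asboolP; exact: subring0.
rewrite (vg_valE x0) /=.
by rewrite [LHS](vg_le_mk nz_one (exist _ x x0)) /= divr1.
Qed.

Lemma vg_val_unit x : x != 0 -> V x -> V x^-1 -> vg_val x = Some 0.
Proof.
move=> x0 Vx Vxv; rewrite (vg_valE x0); congr Some.
by apply/value_class_eq => /=; rewrite divr1 mul1r.
Qed.

End ValueGroup.

Lemma valuation_of_ring (K : fieldType) (V : set K) : subring V ->
  (forall y, y != 0 -> V y \/ V y^-1) ->
  exists (H : porderZmodType) (v : K -> option H),
    [/\ ordered_group H, is_valuation v,
        forall x, (x \in valuation_ring v) = `[< V x >] &
        forall x, x != 0 -> V x -> V x^-1 -> v x = Some 0].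
Proof.
move=> rV vV; exists (value_group rV), (@vg_val _ _ rV); split.
- exact: value_group_ordered.
- exact: vg_val_valuation.
- exact: vg_val_ring.
- exact: vg_val_unit.
Qed.

(** * Expansiveness in terms of characters *)

Lemma circle_nbhs1 (C : numFieldType) (O : set (circle C)) : open O -> O 0 ->
  exists2 e : C, 0 < e & forall z, `|circle_val z - 1| < e -> O z.
Proof.
move=> [U' oU' <-] /= U1.
have : nbhs (1 : C) U' by exact: open_nbhs_nbhs.
move=> /nbhs_ballP[e e0 he]; exists e => // z ze.
by apply: he; rewrite -ball_normE /= distrC.
Qed.

Lemma circle_ball1_open (C : numFieldType) (e : C) :
  open [set z : circle C | `|circle_val z - 1| < e].
Proof.
exists [set z : C | `|1 - z| < e]; last first.
  by apply/seteqP; split=> z /=; rewrite distrC.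
have [e0|e0] := boolP (0 < e).
  by have := @ball_open C C (1 : C) e; rewrite -ball_normE.
have -> : [set z : C | `|1 - z| < e] = set0; last exact: open0.
apply/seteqP; split=> // z /= ze; move/negP: e0; apply.
exact: le_lt_trans (normr_ge0 _) ze.
Qed.

Section DualTopology.
Variables (R : realType) (M : idomainType).
Local Notation C := R[i].
Local Notation D := (discrete_topology M).
Local Notation cv := (@circle_val C).

(** If no list exhausted [K], the sets [K] minus a finite list would generate a proper filter. A
    cluster point [p] is impossible, since the open set [{p}] misses [K] minus [p]. *)
Lemma compact_discrete (K : set D) : compact K -> exists F : seq M, forall x, K x -> x \in F.
Proof.
move=> cK; apply: contrapT => H.
pose FF : set_system D := filter_from [set: seq M] (fun F => [set x | K x /\ x \notin F]).
have fF : ProperFilter FF.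
  apply: filter_from_proper.
    apply: filter_from_filter; first by exists [::].
    move=> F F' _ _; exists (F ++ F') => //= x [Kx].
    by rewrite mem_cat negb_or => /andP[].
  move=> F _; apply: contrapT => K0; apply: H; exists F => x Kx.
  by apply: contrapT => /negP xF; apply: K0; exists x.
have [|p [Kp]] := cK FF fF; first by exists [::] => // x [].
have pF : FF [set x | K x /\ x \notin [:: (p : M)]] by exists [:: (p : M)].
move=> clp; have [x [[_ xp] xE]] := clp _ [set p] pF (discrete_set1 p).
by move: xp; rewrite xE mem_head.
Qed.

Lemma circle_nbhs0 (O : set (circle C)) : open O -> O 0 -> exists2 e : R, 0 < e &
  forall z, cmod (cv z - 1) < e -> O z.
Proof.
move=> oO /(circle_nbhs1 oO)[e e0 he].
(* The order of [R[i]] compares only numbers with equal imaginary parts, so a positive [e] is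
   real. *)
have [eI eR] : complex.Im e == 0 /\ 0 < complex.Re e by move: e0; rewrite ltcE => /andP[].
exists (complex.Re e) => // z ze; apply: he.
by rewrite cmodE ltcE /= ze eI.
Qed.

Lemma circle_ball_open (e : R) : open [set z : circle C | cmod (cv z - 1) < e].
Proof.
have -> : [set z : circle C | cmod (cv z - 1) < e] =
    [set z : circle C | `|cv z - 1| < e%:C%C].
  by apply/seteqP; split=> z /=; rewrite cmodE ltcR.
exact: circle_ball1_open.
Qed.

Let W (F : seq M) (e : R) := [set g : M -> circle C | forall f, f \in F -> cmod (cv (g f) - 1) < e].

(** Compact subsets of a discrete group are finite, so the filter generated by the sets [W F e]
    converges to 0 in the compact-open topology. *)
Lemma dual_nbhs0 (N : set (dual C D)) : nbhs 0 N ->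
  exists F e, 0 < e /\ forall chi : dual C D, W F e chi -> N chi.
Proof.
move=> [_ [[B oB <-] B0 BN]].
pose FF : set_system ({compact-open, D -> circle C}) :=
  filter_from [set Fe : seq M * R | 0 < Fe.2] (fun Fe => W Fe.1 Fe.2).
have fF : Filter FF.
  apply: filter_from_filter; first by exists ([::], 1) => /=.
  move=> [F e] [F' e'] /= e0 e0'; exists (F ++ F', Num.min e e') => /=.
    by rewrite lt_min e0.
  move=> g /= H; split=> f fF; have := H f; rewrite mem_cat fF ?orbT => /(_ isT);
    by rewrite lt_min => /andP[].
have : FF --> (@dual_fun C D 0 : {compact-open, D -> circle C}).
  apply/compact_open_cvgP => K O /compact_discrete[F KF] oO KO.
  have [[x Kx]|K0] := pselect (K !=set0); last first.
    exists ([::], 1); first exact: ltr01.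
    by move=> g _ z [x Kx _]; exfalso; apply: K0; exists x.
  have [e e0 he] : exists2 e : R, 0 < e & forall z, cmod (cv z - 1) < e -> O z.
    by apply: circle_nbhs0 => //; apply: KO; exists x.
  by exists (F, e) => //= g Wg _ [y Ky <-]; apply: he; apply: Wg; exact: KF.
have nB : nbhs (@dual_fun C D 0 : {compact-open, D -> circle C}) B.
  by apply: open_nbhs_nbhs; split.
move=> /(_ _ nB) [[F e] /= e0 WB].
by exists F, e; split=> // chi Wchi; apply: BN; exact: WB.
Qed.

Lemma dual_nbhs0_basic F e : 0 < e -> nbhs (0 : dual C D) [set chi : dual C D | W F e chi].
Proof.
move=> e0; elim: F => [|f F IH].
  by apply: filterE => chi f; rewrite in_nil.
have : nbhs (0 : dual C D) [set chi : dual C D | cmod (cv (chi f) - 1) < e].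
  have cont := @initial_continuous (dual C D) {compact-open, D -> circle C} (@dual_fun C D).
  have : nbhs (@dual_fun C D 0 : {compact-open, D -> circle C})
      [set g | g @` [set (f : D)] `<=` [set z : circle C | cmod (cv z - 1) < e]].
    apply: open_nbhs_nbhs; split.
      apply: (@compact_open_open D (circle C)); first exact: compact_set1.
      exact: circle_ball_open.
    by move=> _ [_ -> <-] /=; rewrite subrr cmod0.
  move=> /(cont 0) Hn; apply: (@filterS _ (nbhs (0 : dual C D)) _ _ _ _ Hn) => chi /= H.
  by apply: H; exists f.
move: IH; apply: filterS2 => chi /= WF Wf g; rewrite in_cons => /orP[/eqP -> //|].
exact: WF.
Qed.

Definition is_char (chi : M -> C) :=
  (forall x, cmod (chi x) = 1) /\ forall x y, chi (x + y) = chi x * chi y.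

Lemma dual_is_char (chi : dual C D) : is_char (fun x => cv (chi x)).
Proof.
split=> [x|x y]; last by rewrite (dualD chi).
by apply: complexI; rewrite -cmodE (eqP (circle_norm (chi x))).
Qed.

Lemma is_char_dual (chi : M -> C) : is_char chi ->
  exists psi : dual C D, forall x, cv (psi x) = chi x.
Proof.
move=> [n1 cD].
have nn x : `|chi x| == 1 by rewrite cmodE n1.
have mD : {morph (fun x : D => Circle (nn x)) : a b / a + b}.
  by move=> a b; apply: val_inj => /=; exact: cD.
by exists (@Dual C D (fun x : D => Circle (nn x)) (@discrete_continuous _ _ _) mD).
Qed.

(** A character lies in the image of [N] under [g] exactly when its translate by [g^-1] lies in [N].
    As [G] is closed under inverses, the intersection becomes a condition on whole orbits. *)
Lemma expansiveP (G : {pred M}) : unit_subgroup G ->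
  expansive (@induced_action R M) [set` G] <->
  exists (F : seq M) (e : R), 0 < e /\ forall chi, is_char chi ->
    (forall g f, g \in G -> f \in F -> cmod (chi (g * f) - 1) < e) -> forall x, chi x = 1.
Proof.
move=> [Gu [G1 Gdiv]].
have GV g : g \in G -> g^-1 \in G by move=> gG; rewrite -div1r; exact: Gdiv.
have actE g (chi : dual C D) x : induced_action g chi x = chi (g * x) by [].
split.
  move=> [N /dual_nbhs0[F [e [e0 WN]]] NG]; exists F, e; split=> // chi chiP H x.
  have [psi psiE] := is_char_dual chiP.
  have : (\bigcap_(g in [set` G]) (induced_action g @` N)) psi.
    move=> g /= gG; exists (induced_action g^-1 psi).
      apply: WN => f fF; rewrite actE psiE; apply: H => //; exact: GV.
    by apply: dual_eqP => y; rewrite !actE mulrA mulVr ?mul1r //; exact: Gu.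
  by rewrite NG -psiE => ->.
move=> [F [e [e0 H]]]; exists [set chi : dual C D | W F e chi]; first exact: dual_nbhs0_basic.
apply/seteqP; split=> [chi cap|_ ->] /=.
  apply: dual_eqP => x; apply: val_inj; apply: (H (fun x => cv (chi x))).
    exact: dual_is_char.
  move=> g f gG fF.
  have [psi Wpsi <-] := cap _ (GV _ gG).
  by rewrite actE mulrA mulVr ?Gu // mul1r; exact: Wpsi.
move=> g gG; exists 0; last by apply: dual_eqP.
by move=> f fF /=; rewrite subrr cmod0.
Qed.

End DualTopology.

(** * Integrality and finite generation *)

Section OrbitSpan.
Variables (M : idomainType) (G : {pred M}) (subG : unit_subgroup G).
Local Notation A := (gen_subring G).

(* The [M_G]-submodule of [M] generated by [F]. *)
Definition orbit_span (F : seq M) : set M := fun m =>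
  forall P : set M, P 0 -> (forall x y, P x -> P y -> P (x - y)) ->
    (forall g f, g \in G -> f \in F -> P (g * f)) -> P m.

Lemma orbit_span0 F : orbit_span F 0. Proof. by move=> P P0 _ _. Qed.

Lemma orbit_spanB F x y : orbit_span F x -> orbit_span F y -> orbit_span F (x - y).
Proof. by move=> hx hy P P0 PB Pg; apply: (PB);
  [exact: (hx P P0 PB Pg) | exact: (hy P P0 PB Pg)]. Qed.

Lemma orbit_span_gen F g f : g \in G -> f \in F -> orbit_span F (g * f).
Proof. by move=> gG fF P P0 PB Pg; exact: Pg. Qed.

Lemma subgroup1 : 1 \in G. Proof. by case: subG => _ [G1 _]. Qed.

Lemma subgroup_unit g : g \in G -> g \is a GRing.unit.
Proof. by case: subG => + _; exact. Qed.

Lemma subgroupV g : g \in G -> g^-1 \in G.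
Proof. by case: subG => _ [G1 Gd] gG; rewrite -div1r; exact: Gd. Qed.

Lemma subgroupM g h : g \in G -> h \in G -> g * h \in G.
Proof.
move=> gG hG; rewrite -(invrK h); case: subG => _ [G1 Gd]; apply: Gd => //.
exact: subgroupV.
Qed.

Lemma orbit_span_sub F f : f \in F -> orbit_span F f.
Proof. by move=> fF; rewrite -(mul1r f); apply: orbit_span_gen => //; exact: subgroup1. Qed.

Lemma orbit_spanD F x y : orbit_span F x -> orbit_span F y -> orbit_span F (x + y).
Proof.
move=> hx hy; rewrite -(opprK y); apply: orbit_spanB => //.
by rewrite -sub0r; apply: orbit_spanB => //; exact: orbit_span0.
Qed.

Lemma orbit_span_sum F (I : finType) (u : I -> M) :
  (forall i, orbit_span F (u i)) -> orbit_span F (\sum_i u i).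
Proof.
move=> hu; apply: (big_ind (orbit_span F)) => [|x y|i _]; last exact: hu.
  exact: orbit_span0.
exact: orbit_spanD.
Qed.

Lemma orbit_spanZ_group F g x : g \in G -> orbit_span F x -> orbit_span F (g * x).
Proof.
move=> gG h; apply: (h (fun x => orbit_span F (g * x))); first by rewrite mulr0; exact: orbit_span0.
  by move=> y z hy hz; rewrite mulrBr; exact: orbit_spanB.
by move=> k f kG fF; rewrite mulrA; apply: orbit_span_gen => //; exact: subgroupM.
Qed.

Lemma gen_subring_sub g : g \in G -> g \in A.
Proof. by move=> gG; apply/asboolP => S hS; exact. Qed.

Lemma gen_subring_ind (P : set M) : P 1 -> (forall x y, P x -> P y -> P (x - y)) ->
  (forall x y, P x -> P y -> P (x * y)) -> (forall g, g \in G -> P g) ->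
  forall a, a \in A -> P a.
Proof.
move=> P1 PB PM PG a /asboolP /(_ (fun x => `[< P x >])) H; apply/asboolP; apply: H.
  split; first exact/asboolP.
    by move=> x y /asboolP Px /asboolP Py; apply/asboolP; exact: PB.
  by move=> x y /asboolP Px /asboolP Py; apply/asboolP; exact: PM.
by move=> g gG; apply/asboolP; exact: PG.
Qed.

Lemma orbit_spanZ F a x : a \in A -> orbit_span F x -> orbit_span F (a * x).
Proof.
move=> aA; move: a aA x; apply: (gen_subring_ind (P := fun a =>
  forall x, orbit_span F x -> orbit_span F (a * x))).
- by move=> x; rewrite mul1r.
- by move=> a b ha hb x hx; rewrite mulrBl; apply: orbit_spanB; [exact: ha | exact: hb].
- by move=> a b ha hb x hx; rewrite -mulrA; apply: ha; exact: hb.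
- by move=> g gG x; exact: orbit_spanZ_group.
Qed.

(** [L] counts the terms in an expression of [m] by generators, so it depends on [m] alone. Its
    uniformity in [w] and [tau] bounds entire sequences of functionals pointwise, and [tau = 0]
    gives a vanishing criterion. *)
Lemma orbit_span_bound (R : realType) F m : orbit_span F m -> exists2 L : R, 0 <= L &
  forall (w : M -> R) tau, 0 <= tau -> w 0 = 0 ->
    (forall x y, w (x - y) <= w x + w y) ->
    (forall g f, g \in G -> f \in F -> w (g * f) <= tau) ->
    forall g, g \in G -> w (g * m) <= L * tau.
Proof.
move=> h; apply: (h (fun m => exists2 L : R, 0 <= L &
  forall (w : M -> R) tau, 0 <= tau -> w 0 = 0 ->
    (forall x y, w (x - y) <= w x + w y) ->
    (forall g f, g \in G -> f \in F -> w (g * f) <= tau) ->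
    forall g, g \in G -> w (g * m) <= L * tau)).
- by exists 0 => // w tau t0 w0 _ _ g _; rewrite mulr0 w0 mul0r.
- move=> x y [L L0 hL] [L' L0' hL']; exists (L + L'); first exact: addr_ge0.
  move=> w tau t0 w0 wB wg g gG; rewrite mulrBr mulrDl.
  by apply: (le_trans (wB _ _)); apply: lerD; [exact: hL | exact: hL'].
- move=> g f gG fF; exists 1 => // w tau _ _ _ wg k kG.
  by rewrite mul1r mulrA; apply: wg => //; exact: subgroupM.
Qed.

Definition integral_over (x : M) := exists n (c : nat -> M),
  (forall i, c i \in A) /\ x ^+ n = \sum_(i < n) c i * x ^+ i.

Definition span_subring F := orbit_span F 1 /\
  forall x y, orbit_span F x -> orbit_span F y -> orbit_span F (x * y).

Lemma span_subring_base : span_subring [:: 1].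
Proof.
split; first by apply: orbit_span_sub; rewrite mem_head.
move=> x y hx hy; apply: (hx (fun x => orbit_span [:: 1] (x * y))).
- by rewrite mul0r; exact: orbit_span0.
- by move=> u v hu hv; rewrite mulrBl; exact: orbit_spanB.
- by move=> g f gG; rewrite inE => /eqP ->; rewrite mulr1; exact: orbit_spanZ_group.
Qed.

(** The generators [f * x ^+ i] with [i < n] suffice: multiplication by [x] raises [i] or, at
    [i = n - 1], is reduced by the integral equation. Stability under [x] and under the old span
    gives stability under products. *)
Lemma span_subring_adjoin F x : span_subring F -> integral_over x ->
  exists F', [/\ span_subring F', orbit_span F `<=` orbit_span F' & orbit_span F' x].
Proof.
move=> [F1 FM] [n [c [cA xn]]].
have n0 : (0 < n)%N.
  by case: n xn => // /eqP; rewrite expr0 big_ord0 oner_eq0.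
pose F' := [seq f * x ^+ i | f <- F, i <- iota 0 n].
have memF' f i : f \in F -> (i < n)%N -> f * x ^+ i \in F'.
  by move=> fF iltn; apply/allpairsP; exists (f, i); rewrite mem_iota.
have FX i u : (i < n)%N -> orbit_span F u -> orbit_span F' (u * x ^+ i).
  move=> iltn hu; apply: (hu (fun u => orbit_span F' (u * x ^+ i))).
  - by rewrite mul0r; exact: orbit_span0.
  - by move=> v w hv hw; rewrite mulrBl; exact: orbit_spanB.
  - by move=> g f gG fF; rewrite -mulrA; apply: orbit_span_gen => //; exact: memF'.
have FF' : orbit_span F `<=` orbit_span F'.
  by move=> u hu; rewrite -(mulr1 u) -(expr0 x); exact: FX.
have xF' u : orbit_span F' u -> orbit_span F' (x * u).
  move=> h; apply: (h (fun u => orbit_span F' (x * u))); first by rewrite mulr0; exact: orbit_span0.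
    by move=> v w hv hw; rewrite mulrBr; exact: orbit_spanB.
  move=> g _ gG /allpairsP[[f i] /= [fF + ->]]; rewrite mem_iota /= add0n => iltn.
  rewrite (_ : x * _ = g * (f * x ^+ i.+1)); last by rewrite exprS; ring.
  apply: orbit_spanZ_group => //; have [lt|] := ltnP i.+1 n.
    by apply: FX => //; exact: orbit_span_sub.
  move=> ge; have -> : i.+1 = n by apply/eqP; rewrite eqn_leq iltn.
  rewrite xn mulr_sumr; apply: orbit_span_sum => j; rewrite mulrCA.
  by apply: orbit_spanZ => //; apply: FX => //; exact: orbit_span_sub.
have FF'M u v : orbit_span F u -> orbit_span F' v -> orbit_span F' (u * v).
  move=> hu hv; apply: (hv (fun v => orbit_span F' (u * v))).
  - by rewrite mulr0; exact: orbit_span0.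
    by move=> y z hy hz; rewrite mulrBr; exact: orbit_spanB.
  move=> g _ gG /allpairsP[[f i] /= [fF + ->]]; rewrite mem_iota /= add0n => iltn.
  rewrite (_ : u * _ = g * ((u * f) * x ^+ i)); last by ring.
  apply: orbit_spanZ_group => //; apply: FX => //; apply: FM => //.
  exact: orbit_span_sub.
exists F'; split=> //; last by rewrite -(mulr1 x); apply: xF'; exact: FF'.
split; first exact: FF'.
move=> u v hu hv; apply: (hu (fun u => orbit_span F' (u * v))).
- by rewrite mul0r; exact: orbit_span0.
- by move=> y z hy hz; rewrite mulrBl; exact: orbit_spanB.
- move=> g _ gG /allpairsP[[f i] /= [fF _ ->]].
  rewrite (_ : _ * v = g * (f * (x ^+ i * v))); last by ring.
  apply: orbit_spanZ_group => //; apply: FF'M; first exact: orbit_span_sub.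
  elim: i => [|i IH]; first by rewrite expr0 mul1r.
  by rewrite exprS -mulrA; exact: xF'.
Qed.

(** Starting from the span of 1, the algebra generators are adjoined one at a time. The final span
    is a subring containing them and [M_G], hence all of [M]. *)
Lemma integral_fin_gen : fin_gen_algebra G -> (forall x, integral_over x) ->
  exists F, forall m, orbit_span F m.
Proof.
move=> [s sM] int.
have [F [[F1 FM] sF]] : exists F, span_subring F /\ forall x, x \in s -> orbit_span F x.
  elim: s {sM} => [|x s [F [hF sF]]].
    by exists [:: 1]; split=> //; exact: span_subring_base.
  have [F' [hF' FF' xF']] := span_subring_adjoin hF (int x).
  by exists F'; split=> // y; rewrite in_cons => /orP[/eqP -> //|/sF /FF'].
exists F => m; have := sM m; rewrite inE.
move=> /asboolP /(_ (fun x => `[< orbit_span F x >])) H; apply/asboolP; apply: H.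
  split; first exact/asboolP.
    by move=> x y /asboolP hx /asboolP hy; apply/asboolP; exact: orbit_spanB.
  by move=> x y /asboolP hx /asboolP hy; apply/asboolP; exact: FM.
move=> x hx; apply/asboolP; move: hx => /orP[xA|xs]; last exact: sF.
by rewrite -(mulr1 x); apply: orbit_spanZ.
Qed.

Local Notation tf := (@FracField.tofrac M).

(** If [x] is not integral, it is not in [M_G[x^-1]], and some valuation ring contains [M_G] but not
    [x]. Elements of [G] have their inverses in [M_G], so they are units of that ring and the
    valuation is trivial on [G]. *)
Lemma valuations_integral :
  (forall (H : porderZmodType) (v : {fraction M} -> option H),
     ordered_group H -> valuations_ZarC v -> (v \o tf) @` [set` G] <> [set Some 0]) ->
  forall x, integral_over x.
Proof.
move=> V2 x.
pose AK : set {fraction M} := [set tf a | a in [set` A]].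
have rAK : subring AK.
  have [A1 AB AM] := @gen_subring_closed M G.
  split; first by exists 1; [exact: A1 | exact: rmorph1].
    by move=> _ _ [a aA <-] [b bA <-]; exists (a - b); [exact: AB | exact: rmorphB].
  by move=> _ _ [a aA <-] [b bA <-]; exists (a * b); [exact: AM | exact: rmorphM].
have [[p pA xE]|/(valuation_ring_exists rAK)] := pselect (adjoin AK (tf x)^-1 (tf x)).
  have [x0|x0] := eqVneq x 0.
    exists 1%N, (fun=> 0); split=> [i|]; first exact: rpred0.
    by rewrite big_ord1 x0 mul0r.
  have tx0 : tf x != 0 by rewrite tofrac_eq0.
  have [c hc] : exists c : nat -> M, forall i, c i \in A /\ tf (c i) = p`_i.
    have /choice[c hc] : forall i, exists a, a \in A /\ tf a = p`_i.
      by move=> i; have [a aA aE] := pA i; exists a.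
    by exists c.
  (* Multiplying [x = sum p_i x^-i] by [x^n], with [n = size p], makes [p_(n-j)] the coefficient of
     [x^j]. For [j = 0] this is [p_n = 0], so the shift to degree [n + 1] is harmless. *)
  exists (size p).+1, (fun j => c (size p - j)%N); split=> [i|]; first by case: (hc (size p - i)%N).
  have inj : injective tf by move=> a b /eqP; rewrite tofrac_eq => /eqP.
  set n := size p; apply: inj; rewrite rmorph_sum /= big_ord_recl.
  rewrite rmorphM /= (hc (n - 0)%N).2 subn0 nth_default // mul0r add0r.
  rewrite rmorphXn /= exprS -{1}xE horner_coef mulr_suml (reindex_inj rev_ord_inj).
  apply: eq_bigr => i _; rewrite rmorphM /= (hc _).2 rmorphXn /= /bump /= add1n.
  rewrite -mulrA; congr (_ * _).
  have -> : tf x ^+ n = tf x ^+ (n - i.+1) * tf x ^+ i.+1 by rewrite -exprD subnK.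
  by rewrite mulrA exprVn mulVf ?mul1r // expf_neq0.
move=> [V [rV vV AV nVx]].
have [H [v [oH vP vring vunit]]] := valuation_of_ring rV vV.
exfalso; apply: (V2 H v oH).
  split=> //; split; last first.
    by case=> _ _ /(_ (tf x)) h; apply: nVx; apply/asboolP; rewrite -vring; apply: h; exists x.
  split.
  - split.
    + by rewrite vring; apply/asboolP; exact: subring1.
    + move=> y z; rewrite !vring => /asboolP Vy /asboolP Vz; apply/asboolP.
      exact: subringB.
    + move=> y z; rewrite !vring => /asboolP Vy /asboolP Vz; apply/asboolP.
      exact: subringM.
  - by move=> y y0; rewrite !vring; case: (vV y y0) => Vy; [left|right]; apply/asboolP.
  - move=> _ [k _ <-]; rewrite vring; apply/asboolP; apply: AV.
    by exists k%:~R; rewrite ?rmorph_int //; exact: rpred_int.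
have vG g : g \in G -> v (tf g) = Some 0.
  move=> gG; apply: vunit.
  - by rewrite tofrac_eq0; apply: contraTneq (subgroup_unit gG) => ->; rewrite unitr0.
  - by apply: AV; exists g => //; exact: gen_subring_sub.
  - apply: AV; exists g^-1; first by apply: gen_subring_sub; exact: subgroupV.
    by rewrite rmorphV //; exact: subgroup_unit.
apply/seteqP; split=> [_ [g gG <-]|_ ->] /=; first exact: vG.
by exists 1; [exact: subgroup1 | apply: vG; exact: subgroup1].
Qed.

(** Let [f] be a nonzero generator of least value. Then [m / f] is in [V] for all [m] in the span,
    that is, in [M]. Taking [m = f^2] shows that [f] is in [V], and so is [m = (m / f) f]. *)
Lemma orbit_span_valuation F (V : {pred {fraction M}}) : (forall m, orbit_span F m) ->
  GRing.subring_closed V -> (forall x, x != 0 -> x \in V \/ x^-1 \in V) ->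
  (forall g, g \in G -> tf g \in V) -> forall m, tf m \in V.
Proof.
move=> spanF sV vV GV.
have rV : subring [set x | x \in V] by case: sV.
pose dom f f' := tf f' / tf f \in V.
have [f fF fdom] : exists2 f, f != 0 & f \in F /\ {in F, forall f', dom f f'}.
  have : exists2 f, f \in F & f != 0.
    apply: contrapT => H.
    have /eqP : (1 : M) = 0.
      have h := spanF 1 (fun x => x = 0) erefl.
      apply: h; first by move=> x y -> ->; rewrite subrr.
      move=> g f _ fF; have [->|f0] := eqVneq f 0; first by rewrite mulr0.
      by exfalso; apply: H; exists f.
    by rewrite oner_eq0.
  elim: F {spanF} => [|f F IH] [f1]; first by rewrite in_nil.
  have [H|H] := pselect (exists2 f, f \in F & f != 0); last first.
    rewrite in_cons => /orP[/eqP -> f0|f1F f10]; last by exfalso; apply: H; exists f1.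
    exists f => //; split; first exact: mem_head.
    move=> f'; rewrite in_cons => /orP[/eqP -> |f'F].
      by rewrite /dom divff ?tofrac_eq0 //; exact: subring1 rV.
    have -> : f' = 0 by apply: contrapT => /eqP h; apply: H; exists f'.
    by rewrite /dom rmorph0 mul0r; exact: subring0 rV.
  move=> _ _; have [f2 f20 [f2F f2dom]] := IH H.
  have [f0|f0] := eqVneq f 0.
    exists f2 => //; split=> [|f']; first by rewrite in_cons f2F orbT.
    rewrite in_cons => /orP[/eqP -> |]; last exact: f2dom.
    by rewrite /dom f0 rmorph0 mul0r; exact: subring0 rV.
  have tf0 : tf f != 0 by rewrite tofrac_eq0.
  have tf20 : tf f2 != 0 by rewrite tofrac_eq0.
  have /vV : tf f / tf f2 != 0 by rewrite mulf_neq0 ?invr_neq0.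
  rewrite invf_div => -[h|h].
    exists f2 => //; split=> [|f']; first by rewrite in_cons f2F orbT.
    by rewrite in_cons => /orP[/eqP -> //|]; exact: f2dom.
  exists f => //; split=> [|f']; first exact: mem_head.
  rewrite in_cons => /orP[/eqP -> |/f2dom h']; rewrite /dom.
    by rewrite divff //; exact: subring1 rV.
  have -> : tf f' / tf f = (tf f' / tf f2) * (tf f2 / tf f) by rewrite mulrA divfK.
  exact: subringM rV _ _ h' h.
have tf0 : tf f != 0 by rewrite tofrac_eq0.
have divV m : tf m / tf f \in V.
  apply: (spanF m (fun m => tf m / tf f \in V)).
  - by rewrite rmorph0 mul0r; exact: subring0 rV.
  - by move=> x y hx hy; rewrite rmorphB mulrBl; exact: subringB rV _ _ hx hy.
  - move=> g f' gG f'F; rewrite rmorphM -mulrA.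
    by apply: (subringM rV); [exact: GV | exact: fdom.2].
have fV : tf f \in V.
  by have := divV (f * f); rewrite rmorphM mulfK.
move=> m; rewrite -(divfK tf0 (tf m)); exact: subringM rV _ _ (divV m) fV.
Qed.

End OrbitSpan.

(** * Extension of characters *)

Section CharacterExtension.
Variables (R : realType) (M : idomainType).
Local Notation C := R[i].
Implicit Types (Gam : set (M * C)) (x y : M) (a b z : C).

(** For [a = 1] a primitive root of unity serves; otherwise every root differs from 1 because its
    power does. *)
Lemma unimodular_root n a : (1 < n)%N -> cmod a = 1 ->
  exists z, [/\ cmod z = 1, z ^+ n = a & z != 1].
Proof.
move=> n1 a1; have n0 : (0 < n)%N by exact: ltnW.
have cm z : cmod (z ^+ n) = 1 -> cmod z = 1.
  by rewrite cmodX => /eqP; rewrite pexpr_eq1 ?cmod_ge0 // => /eqP.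
have [ae|ane] := eqVneq a 1.
  have [z pz] := @primitive_root_exists C n n0; exists z.
  have zn := prim_expr_order pz; split; [|by rewrite zn ae|].
    by apply: cm; rewrite zn cmod1.
  have := prim_order_dvd pz 1; rewrite expr1 => <-.
  by rewrite dvdn1; apply/negP => /eqP nE; rewrite nE in n1.
have zn : n.-root a ^+ n = a by exact: rootCK.
exists (n.-root a); split=> //; first by apply: cm; rewrite zn.
by apply: contra_neq ane => z1; rewrite -zn z1 expr1n.
Qed.

(* The graph of a unitary character of a subgroup of [M]. *)
Definition partial_char Gam :=
  [/\ Gam (0, 1), forall x a y b, Gam (x, a) -> Gam (y, b) -> Gam (x - y, a / b),
      forall a, Gam (0, a) -> a = 1 & forall x a, Gam (x, a) -> cmod a = 1].

Section Graph.
Variables (Gam : set (M * C)) (gP : partial_char Gam).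

Lemma partial_char_neq0 x a : Gam (x, a) -> a != 0.
Proof. by case: gP => _ _ _ h /h a1; rewrite -cmod_eq0 a1 oner_eq0. Qed.

Lemma partial_char_inj x a b : Gam (x, a) -> Gam (x, b) -> a = b.
Proof.
move=> ha hb; have b0 := partial_char_neq0 hb; case: gP => _ hB h1 _.
have := h1 (a / b); rewrite -(subrr x) => /(_ (hB _ _ _ _ ha hb)) /divr1_eq; exact.
Qed.

Lemma partial_charV x a : Gam (x, a) -> Gam (- x, a^-1).
Proof. by case: gP => h0 hB _ _ ha; have := hB _ _ _ _ h0 ha; rewrite sub0r div1r. Qed.

Lemma partial_charM x a y b : Gam (x, a) -> Gam (y, b) -> Gam (x + y, a * b).
Proof.
case: (gP) => _ hB _ _ ha /partial_charV hb.
by have := hB _ _ _ _ ha hb; rewrite opprK invrK.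
Qed.

Lemma partial_charX x a n : Gam (x, a) -> Gam (x *+ n, a ^+ n).
Proof.
move=> ha; elim: n => [|n IH]; first by case: gP.
by rewrite mulrS exprS; exact: partial_charM.
Qed.

Lemma partial_charZ x a (k : int) : Gam (x, a) -> Gam (x *~ k, a ^ k).
Proof.
move=> ha; case: k => n; first by exact: partial_charX.
by apply: partial_charV; exact: partial_charX.
Qed.

(** If some positive multiple of [x] is in the domain, let [n] be the least one; then [n > 1], and
    [z] is an [n]-th root of the value prescribed at [n x]. If there is none, every unimodular [z]
    is consistent and [-1] is taken. The condition [z != 1] makes the extension detect [x]. *)
Lemma partial_char_extend x : (forall a, ~ Gam (x, a)) ->
  exists Gam' z, [/\ partial_char Gam', Gam `<=` Gam', Gam' (x, z) & z != 1].
Proof.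
move=> xdom.
have [z [z1 zn1 zP]] : exists z, [/\ cmod z = 1, z != 1 &
    forall (k : int) b, Gam (x *~ k, b) -> b = z ^ k].
  have [hn|hn] := pselect (exists n, (0 < n)%N /\ `[< exists a, Gam (x *+ n, a) >]); last first.
    exists (-1); split; first by rewrite cmodN cmod1.
      by rewrite eq_sym -addr_eq0 -(natrD _ 1 1) pnatr_eq0.
    have hn' n b : (0 < n)%N -> ~ Gam (x *+ n, b).
      by move=> n0 h; apply: hn; exists n; split=> //; apply/asboolP; exists b.
    case=> [[|n]|n] b hb.
    - by case: gP => _ _ h _; rewrite (h b hb).
    - by exfalso; apply: hn' hb.
    - by have := partial_charV hb; rewrite /= opprK => /hn' [].
  pose p n := (0 < n)%N && `[< exists a, Gam (x *+ n, a) >].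
  have ep : exists n, p n by have [n [n0 h]] := hn; exists n; rewrite /p n0.
  case: (ex_minnP ep) => n /andP[n0 /asboolP[a ha]] nmin.
  have n1 : (1 < n)%N.
    rewrite ltn_neqAle n0 andbT; apply/negP => /eqP n1.
    by apply: (xdom a); rewrite -n1 in ha.
  have a1 : cmod a = 1 by case: gP => _ _ _; apply; exact: ha.
  have [z [z1 zn zne]] := unimodular_root n1 a1.
  exists z; split=> // k b hb.
  have z0 : z != 0 by rewrite -cmod_eq0 z1 oner_eq0.
  (* Division with remainder: [r] is below the least [n], so the presence of [r x] in the domain
     forces [r = 0]. *)
  have kE := divz_eq k n%:Z; set q := (k %/ n)%Z in kE; set r := (k %% n)%Z in kE.
  have r0 : 0 <= r by apply: modz_ge0; rewrite eqz_nat -lt0n.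
  have rn : r < n%:Z by apply: ltz_pmod; rewrite ltz_nat.
  have hq : Gam (x *~ (q * n%:Z), a ^ q).
    by rewrite mulrC mulrzA; exact: partial_charZ ha.
  have hr : Gam (x *~ r, b / a ^ q).
    have -> : x *~ r = x *~ k - x *~ (q * n%:Z) by rewrite -mulrzBr {1}kE addrAC subrr add0r.
    by case: gP => _ hB _ _; exact: hB.
  have rE : r = 0.
    apply/eqP; case: (r) r0 rn hr => // -[//|r'] _ rn hr.
    have /nmin : p r'.+1 by rewrite /p /=; apply/asboolP; exists (b / a ^ q).
    by rewrite leqNgt -ltz_nat rn.
  have : b / a ^ q = 1 by case: gP => _ _ h _; apply: h; rewrite rE in hr.
  by move/divr1_eq ->; rewrite -zn kE rE addr0 exprnP exprz_exp mulrC.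
have z0 : z != 0 by rewrite -cmod_eq0 z1 oner_eq0.
pose Gam' : set (M * C) := [set p | exists y b (k : int),
  Gam (y, b) /\ p = (y + x *~ k, b * z ^ k)].
exists Gam', z; split=> //.
- split.
  + by exists 0, 1, 0; split; [by case: gP | rewrite addr0 mulr1].
  + move=> _ _ _ _ [y [b [k [h [-> ->]]]]] [y' [b' [k' [h' [-> ->]]]]].
    exists (y - y'), (b / b'), (k - k'); split; first by case: gP => _ hB _ _; exact: hB.
    congr (_, _); first by rewrite mulrzBr opprD addrACA.
    by rewrite expfzDr // -invr_expz invfM mulrACA.
  + move=> a [y [b [k [h [y0 ->]]]]].
    have yE : y = x *~ (- k) by apply/eqP; rewrite mulrNz -addr_eq0 -y0.
    by rewrite yE in h; rewrite (zP _ _ h) -expfzDr // addNr.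
  + move=> u _ [y [b [k [h [_ ->]]]]]; rewrite cmodM.
    have -> : cmod b = 1 by case: gP => _ _ _; apply; exact: h.
    have zX n : cmod (z ^+ n) = 1 by rewrite cmodX z1 expr1n.
    by rewrite mul1r; case: k => n; rewrite /exprz ?cmodV zX ?invr1.
- by move=> [y b] h; exists y, b, 0; rewrite addr0 mulr1.
- by exists 0, 1, 1; split; [by case: gP | rewrite add0r mul1r].
Qed.

End Graph.

(** The trivial character of [S] is first extended to [x] with a value other than 1. A maximal
    further extension is defined everywhere, since otherwise it could be extended once more. *)
Lemma char_separates (S : set M) x : S 0 -> (forall u v, S u -> S v -> S (u - v)) ->
  ~ S x -> exists chi : M -> C, [/\ is_char chi, forall s, S s -> chi s = 1 & chi x != 1].
Proof.
move=> S0 SB nSx.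
pose Gam0 : set (M * C) := [set p | S p.1 /\ p.2 = 1].
have gP0 : partial_char Gam0.
  split=> [|u a v b|a [] //|u a [_ /= ->]]; [by split | | exact: cmod1].
  by move=> [/= Su ->] [/= Sv ->]; split=> /=; [exact: SB | rewrite divr1].
have [|Gam1 [z [gP1 sub1 xz z1]]] := partial_char_extend gP0 (x := x).
  by move=> a [].
have [//|F [X FX] FP Ft|Gam gP [sub maxG]] := @Zorn_above _ partial_char Gam1.
  have H p p' : (\bigcup_(X in F) X) p -> (\bigcup_(X in F) X) p' ->
      exists2 Y, F Y & Y p /\ Y p'.
    move=> [Y FY Yx] [Z FZ Zy]; case: (Ft _ _ FY FZ) => s.
      by exists Z => //; split=> //; exact: s.
    by exists Y => //; split=> //; exact: s.
  split.
  - by exists X => //; case: (FP _ FX).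
  - move=> u a v b hu hv; have [Y FY [Yu Yv]] := H _ _ hu hv.
    by exists Y => //; case: (FP _ FY) => _ h _ _; exact: h.
  - by move=> a [Y FY Ya]; case: (FP _ FY) => _ _ h _; exact: h.
  - by move=> u a [Y FY Ya]; case: (FP _ FY) => _ _ _ h; exact: h Ya.
have tot y : exists a, Gam (y, a).
  apply: contrapT => H; have [|G' [w [gP' sub' yw _]]] := partial_char_extend gP (x := y).
    by move=> a ha; apply: H; exists a.
  by apply: H; exists w; rewrite -(maxG _ gP' sub').
have /choice[chi chiP] := tot.
exists chi; split.
- split=> [y|y w]; first by case: gP => _ _ _; apply; exact: chiP.
  by apply: (partial_char_inj gP (chiP _)); exact: partial_charM.
- move=> s Ss; apply: (partial_char_inj gP (chiP _)).
  by apply: sub; apply: sub1; split.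
- by rewrite (partial_char_inj gP (chiP x) (sub _ xz)).
Qed.

(** A character trivial on the span of [F] meets every smallness condition, so it must be trivial;
    but characters separate the span from any point outside it. *)
Lemma expansive_orbit_span (G : {pred M}) : unit_subgroup G ->
  forall F (e : R), 0 < e -> (forall chi, is_char chi ->
    (forall g f, g \in G -> f \in F -> cmod (chi (g * f) - 1) < e) -> forall x, chi x = 1) ->
  forall m, orbit_span G F m.
Proof.
move=> sG F e e0 H m; apply: contrapT => nm.
have [chi [chiP chiS]] :=
  char_separates (@orbit_span0 _ G F) (@orbit_spanB _ G F) nm.
rewrite H ?eqxx // => g f gG fF; rewrite chiS ?subrr ?cmod0 //.
exact: orbit_span_gen.
Qed.

End CharacterExtension.

(** * Linear functionals and unitary homomorphisms *)

Section LinearFunctional.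
Variables (M : idomainType) (G : {pred M}) (F : seq M).
Hypothesis spanF : forall m, orbit_span G F m.
Local Notation A := (gen_subring_of G).
Local Notation vA := (@gen_subring_val M G).
Local Notation n := (size F).
Variables (C : fieldType) (phi : {rmorphism A -> C}).

Let comb (a : 'rV[A]_n) : M := \sum_i vA (a 0 i) * F`_i.

Let combB a b : comb (a - b) = comb a - comb b.
Proof.
by rewrite /comb -sumrB; apply: eq_bigr => i _; rewrite !mxE -mulrBl.
Qed.

Let combZ c a : comb (c *: a) = vA c * comb a.
Proof.
by rewrite /comb mulr_sumr; apply: eq_bigr => i _; rewrite !mxE mulrA.
Qed.

Let comb_delta i : comb (delta_mx 0 i) = F`_i.
Proof.
rewrite /comb (bigD1 i) //= big1 => [|j ji].
  by rewrite mxE !eqxx mul1r addr0.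
by rewrite mxE (negbTE ji) andbF mul0r.
Qed.

Let comb_onto m : exists a, comb a = m.
Proof.
have h := spanF m; apply: (h (fun m => exists a, comb a = m)).
- by exists 0; rewrite /comb big1 // => i _; rewrite mxE mul0r.
- by move=> x y [a <-] [b <-]; exists (a - b); rewrite combB.
- move=> g f gG fF; pose i := Ordinal (etrans (index_mem f F) fF : index f F < n)%N.
  pose g' : A := GenSubring (gen_subring_sub gG).
  by exists (g' *: delta_mx 0 i); rewrite combZ comb_delta /= nth_index.
Qed.

Local Notation mphi := (map_mx phi).

(** By the adjugate matrix, the determinant [d] of [n] relations kills every generator. If [phi d]
    is nonzero, so is [d], and the generators vanish in the domain [M], although 1 is in their
    span. *)
Let no_full_relations (B : 'M[A]_n) :
  (forall i, comb (row i B) = 0) -> row_free (mphi B) -> False.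
Proof.
rewrite row_free_unit unitmxE unitfE det_map_mx => Brel dB.
have d0 : vA (\det B) != 0.
  apply: contraNneq dB => d0; rewrite (_ : \det B = 0) ?rmorph0 //.
  by apply: val_inj.
have combM a : comb (a *m B) = 0.
  rewrite mulmx_sum_row (big_morph comb (id1 := 0) (op1 := +%R)) //.
  - by rewrite big1 // => i _; rewrite combZ Brel mulr0.
  - by move=> x y; rewrite -[in LHS](opprK y) combB -scaleN1r combZ /= mulN1r opprK.
  - by rewrite /comb big1 // => i _; rewrite mxE mul0r.
have F0 f : f \in F -> f = 0.
  move=> fF; pose i := Ordinal (etrans (index_mem f F) fF : index f F < n)%N.
  have := combM (delta_mx 0 i *m \adj B).
  rewrite -mulmxA mul_adj_mx mul_mx_scalar combZ comb_delta /= nth_index //.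
  by move/eqP; rewrite mulf_eq0 (negbTE d0) => /eqP.
have /eqP : (1 : M) = 0; last by rewrite oner_eq0.
have h := spanF 1; apply: (h (fun x => x = 0)) => // [x y -> ->|g f _ /F0 ->].
  by rewrite subrr.
by rewrite mulr0.
Qed.

(** Equivalently, the base change of [M] along [phi] is nonzero. Take relations whose images under
    [phi] are independent, in the largest possible number [k]. Then [k < n], so some [u] is killed
    by them, and by maximality the image of every other relation lies in their row space. *)
Let relations_kernel : exists2 u : 'cV[C]_n, u != 0 &
  forall a : 'rV[A]_n, comb a = 0 -> mphi a *m u = 0.
Proof.
pose p k := `[< exists B : 'M[A]_(k, n), (forall i, comb (row i B) = 0) /\ row_free (mphi B) >].
have p0 : exists k, p k.
  exists 0%N; apply/asboolP; exists 0; split; first by case.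
  by rewrite /row_free [mphi _]flatmx0 mxrank0.
have pn k : p k -> (k <= n)%N.
  by move=> /asboolP[B [_ /eqP <-]]; exact: rank_leq_col.
case: (ex_maxnP p0 pn) => k /asboolP[B [Brel Bfree]] kmax.
have kn : (k < n)%N.
  rewrite ltn_neqAle (pn k) ?andbT; last by apply/asboolP; exists B.
  apply/negP => /eqP kE; subst k.
  exact: no_full_relations Brel Bfree.
have [v vker v0] : exists2 v : 'rV[C]_n, v *m (mphi B)^T = 0 & v != 0.
  have : kermx (mphi B)^T != 0.
    rewrite -mxrank_eq0 mxrank_ker subn_eq0 -ltnNge mxrank_tr.
    by rewrite (eqP Bfree).
  move=> /rowV0Pn[v /sub_kermxP vk v0]; by exists v.
exists v^T; first by rewrite trmx_eq0.
move=> a ha; have [/submxP[D ->]|nsub] := boolP (mphi a <= mphi B)%MS.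
  by rewrite -mulmxA -[X in D *m X]trmxK trmx_mul trmxK vker trmx0 mulmx0.
exfalso; suff /kmax : p (k + 1)%N by rewrite addn1 ltnn.
apply/asboolP; exists (col_mx B a); split.
  move=> i; case: (splitP i) => j ij.
    have -> : i = lshift 1 j by apply: val_inj.
    by rewrite rowKu.
  have -> : i = rshift k j by apply: val_inj.
  by rewrite rowKd ord1 row_id.
rewrite /row_free map_col_mx eqn_leq rank_leq_row /= -addsmxE addn1.
rewrite -[in X in (X < _)%N](eqP Bfree); apply: rank_ltmx.
by rewrite ltmxE addsmxSl addsmx_sub submx_refl.
Qed.

(** The element with coordinates [a] is sent to [phi(a) u], which is well defined because [u] is
    killed by all relations. *)
Lemma linear_functional : exists h : M -> C,
  [/\ forall x y, h (x + y) = h x + h y, forall a m, h (vA a * m) = phi a * h m &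
      exists m, h m != 0].
Proof.
have [u u0 urel] := relations_kernel.
have /choice[c cE] := comb_onto.
pose h m := (mphi (c m) *m u) 0 0.
have hE a m : comb a = m -> h m = (mphi a *m u) 0 0.
  move=> am; apply/eqP; rewrite /h -subr_eq0 -[X in X == 0]/(_).
  have := urel (c m - a); rewrite combB cE am subrr => /(_ erefl).
  by rewrite map_mxB mulmxBl => /matrixP/(_ 0 0); rewrite !mxE => ->.
exists h; split.
- move=> x y; rewrite (hE (c x - (- c y))).
    by rewrite map_mxB map_mxN opprK mulmxDl mxE.
  by rewrite combB -scaleN1r combZ !cE /= mulN1r opprK.
- move=> a m; rewrite (hE (a *: c m)); last by rewrite combZ cE.
  by rewrite map_mxZ -scalemxAl mxE.
have [i ui] : exists i, u i 0 != 0.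
  apply: contrapT => H; move/eqP: u0; apply; apply/matrixP => i j.
  rewrite ord1 [RHS]mxE; apply: contrapT => /eqP ui; by apply: H; exists i.
exists (F`_i); rewrite (hE (delta_mx 0 i) _ (comb_delta i)).
by rewrite map_delta_mx -rowE mxE.
Qed.

End LinearFunctional.

(** * Small characters from a unitary homomorphism *)

Section UnitaryHomomorphism.
Variables (R : realType).
Local Notation C := R[i].

Definition expi (t : R) : C := (cos t +i* sin t)%C.

Lemma expiD s t : expi (s + t) = expi s * expi t.
Proof. by rewrite /expi cosD sinD; apply/eqP; rewrite eq_complex /= addrC eqxx addrC eqxx. Qed.

Lemma cmod_expi t : cmod (expi t) = 1.
Proof.
have /eqP : cmod (expi t) ^+ 2 = 1 by rewrite cmod_sqr /= cos2Dsin2.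
by rewrite sqrp_eq1 ?cmod_ge0 // => /eqP.
Qed.

Lemma expi_near0 (e : R) : 0 < e ->
  exists2 d : R, 0 < d & forall t, `|t| < d -> cmod (expi t - 1) < e.
Proof.
move=> e0.
have hc : \forall t \near (0 : R), `|cos t - 1| < e / 2.
  have := @continuous_cos R 0; rewrite /continuous_at cos0 => /cvgr_dist_lt.
  move=> /(_ (e / 2)); rewrite divr_gt0 // => /(_ isT).
  by apply: filterS => t; rewrite distrC.
have hs : \forall t \near (0 : R), `|sin t| < e / 2.
  have := @continuous_sin R 0; rewrite /continuous_at sin0 => /cvgr_dist_lt.
  move=> /(_ (e / 2)); rewrite divr_gt0 // => /(_ isT).
  by apply: filterS => t; rewrite sub0r normrN.
have /nbhs_ballP[d d0 hd] : \forall t \near (0 : R), cmod (expi t - 1) < e.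
  apply: filterS2 hc hs => t ht1 ht2.
  have -> : expi t - 1 = (cos t - 1)%:C%C + 'i%C * (sin t)%:C%C.
    by apply/eqP; rewrite eq_complex /= !(mul0r, mul1r, subr0, addr0, add0r) !eqxx.
  apply: (le_lt_trans (cmodD _ _)); rewrite cmodM !cmod_real.
  have -> : cmod ('i%C : C) = 1.
    have /eqP : cmod ('i%C : C) ^+ 2 = 1 by rewrite cmod_sqr /= expr0n expr1n add0r.
    by rewrite sqrp_eq1 ?cmod_ge0 // => /eqP.
  by rewrite mul1r; lra.
exists d => // t td; apply: hd; by rewrite -ball_normE /= sub0r normrN.
Qed.

Variables (M : idomainType) (G : {pred M}).

(** As [phi] is unitary on [G], the [phi]-linear functional [h] has constant modulus on each orbit.
    Hence [y] is bounded on the orbits of [F], and [expi (t * y m)] is close to 1 there for small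
    [t]. *)
Lemma unitary_not_expansive F (e : R) (phi : {rmorphism gen_subring_of G -> C}) :
  0 < e -> (forall m, orbit_span G F m) ->
  (forall a, gen_subring_val a \in G -> cmod (phi a) = 1) ->
  exists chi, [/\ is_char chi,
    forall g f, g \in G -> f \in F -> cmod (chi (g * f) - 1) < e &
    exists x : M, chi x != 1].
Proof.
move=> e0 spanF phi1.
have [h [hD hZ [m0 hm0]]] := linear_functional spanF phi.
have [d d0 hd] := expi_near0 e0.
(* Multiplying by the conjugate of [h m0] makes [y m0] the square of its modulus, hence positive. *)
pose c := ((h m0)^*)%C; pose y m : R := complex.Re (c * h m).
have yD x z : y (x + z) = y x + y z by rewrite /y hD mulrDr ReD.
have y0 : 0 < y m0.
  have -> : y m0 = cmod (h m0) ^+ 2.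
    by rewrite cmod_sqr /y /c; case: (h m0) => a b /=; ring.
  by rewrite exprn_gt0 // cmod_gt0.
have [B B0 yB] : exists2 B, 0 < B & forall g f, g \in G -> f \in F -> `|y (g * f)| <= B.
  have [B0 B00 hB] : exists2 B0, 0 <= B0 & {in F, forall f, cmod (h f) <= B0}.
    elim: (F) => [|f F' [B0 B00 hB]]; first by exists 0.
    exists (B0 + cmod (h f)); first by rewrite addr_ge0 // cmod_ge0.
    move=> f'; rewrite in_cons => /orP[/eqP ->|/hB]; first by rewrite lerDr.
    by move=> /le_trans; apply; rewrite lerDl cmod_ge0.
  exists (cmod c * B0 + 1); first by rewrite ltr_wpDl // mulr_ge0 // cmod_ge0.
  move=> g f gG fF; apply: (le_trans (Re_le_cmod _)).
  have := hZ (GenSubring (gen_subring_sub gG)) f => /= ->.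
  rewrite !cmodM phi1 // mul1r; apply: (@le_trans _ _ (cmod c * B0)); last by rewrite lerDl.
  by apply: ler_wpM2l; [exact: cmod_ge0 | exact: hB].
(* The first bound keeps [t y] within [d] on the orbits of [F]. The second keeps [t y(m0)] in
   [(0, 1]], where the sine is positive, so the character is nontrivial at [m0]. *)
pose t := Num.min (d / (2 * B)) (1 / y m0).
have t0 : 0 < t by rewrite lt_min !divr_gt0 // mulr_gt0.
have tB : t * B < d.
  have : t <= d / (2 * B) by rewrite ge_min lexx.
  rewrite ler_pdivlMr ?mulr_gt0 //; nra.
have ty : t * y m0 <= 1.
  by rewrite -ler_pdivlMr // ge_min lexx orbT.
exists (fun m => expi (t * y m)); split.
- split=> [x|x z]; first exact: cmod_expi.
  by rewrite yD mulrDr expiD.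
- move=> g f gG fF; apply: hd; rewrite normrM gtr0_norm //.
  apply: le_lt_trans tB; apply: ler_wpM2l; [exact: ltW | exact: yB].
exists m0; apply/eqP => /(congr1 (@complex.Im R)) /= s0.
have : 0 < sin (t * y m0).
  apply: sin_gt0_pi; rewrite mulr_gt0 //=.
  by apply: (le_lt_trans ty); apply: lt_le_trans (pi_ge2 R); lra.
by rewrite s0 ltxx.
Qed.

End UnitaryHomomorphism.

(** * Joint eigenfunctions *)

Section JointEigenfunction.
Variables (R : realType) (M : idomainType) (G : {pred M}) (subG : unit_subgroup G).
Variables (F : seq M) (spanF : forall m, orbit_span G F m).
Local Notation C := R[i].

Definition orbit_values (w : M -> R) : set R :=
  [set r | exists g f, [/\ g \in G, f \in F & r = w (g * f)]].

(** Applied to the modulus of an additive [h] bounded on orbits, this is a norm for which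
    translation by elements of [G] is isometric. *)
Definition orbit_sup (w : M -> R) : R := sup (orbit_values w).

Definition orbit_bounded (w : M -> R) := exists B, forall g f,
  g \in G -> f \in F -> w (g * f) <= B.

Lemma generators_neq_nil : exists f, f \in F.
Proof.
apply: contrapT => H; have /eqP : (1 : M) = 0; last by rewrite oner_eq0.
have h := spanF 1; apply: (h (fun x => x = 0)) => // [x y -> ->|g f _ fF].
  by rewrite subrr.
by exfalso; apply: H; exists f.
Qed.

Lemma orbit_has_sup w : orbit_bounded w -> has_sup (orbit_values w).
Proof.
move=> [B wB]; split.
  have [f fF] := generators_neq_nil; exists (w (1 * f)), 1, f; split=> //.
  exact: subgroup1.
by exists B => _ [g [f [gG fF ->]]]; exact: wB.
Qed.

Lemma orbit_sup_ub w g f : orbit_bounded w -> g \in G -> f \in F ->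
  w (g * f) <= orbit_sup w.
Proof.
by move=> bw gG fF; apply: sup_upper_bound; [exact: orbit_has_sup | exists g, f].
Qed.

Lemma orbit_sup_le w b : (forall g f, g \in G -> f \in F -> w (g * f) <= b) ->
  orbit_sup w <= b.
Proof.
move=> wb; apply: ge_sup; first by case: (@orbit_has_sup w) => //; exists b.
by move=> _ [g [f [gG fF ->]]]; exact: wb.
Qed.

Lemma orbit_sup_attained w : orbit_bounded w -> 0 < orbit_sup w ->
  exists g f, [/\ g \in G, f \in F & orbit_sup w / 2 <= w (g * f)].
Proof.
move=> bw s0; have s2 : 0 < orbit_sup w / 2 by rewrite divr_gt0.
have [r [g [f [gG fF ->]]]] := sup_adherent s2 (orbit_has_sup bw).
by rewrite -/(orbit_sup w) => h; exists g, f; split=> //; lra.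
Qed.

Lemma orbit_zero (w : M -> R) : (forall x, 0 <= w x) -> w 0 = 0 ->
  (forall x y, w (x - y) <= w x + w y) ->
  (forall g f, g \in G -> f \in F -> w (g * f) <= 0) -> forall x, w x = 0.
Proof.
move=> w_ge0 w0 wB w1 x; have [L L0 hL] := orbit_span_bound subG R (spanF x).
apply/eqP; rewrite eq_le w_ge0 andbT.
by have := hL w 0 (lexx 0) w0 wB w1 1 (subgroup1 subG); rewrite mul1r mulr0.
Qed.

Variables (U : set_system nat) (UU : UltraFilter U) (UN : \oo `<=` U).

(** The last clause makes the defect of additivity vanish in the limit. The lower bound is required
    on [F] itself, not on its orbits, since only a finite set of arguments lets it pass to an
    ultralimit. *)
Definition normalized (h : nat -> M -> C) :=
  [/\ forall k, h k 0 = 0,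
      forall k x y, cmod (h k (x - y)) <= cmod (h k x) + cmod (h k y),
      forall k g f, g \in G -> f \in F -> cmod (h k (g * f)) <= 1,
      forall k, exists2 f, f \in F & 1 / 2 <= cmod (h k f) &
      forall k x y, cmod (h k (x + y) - (h k x + h k y)) <=
         (cmod (h k x) * cmod (h k y)) / k.+1%:R].

Lemma normalized_bounded h x : normalized h -> bounded_seq (fun k => h k x).
Proof.
move=> [h0 hB h1 _ _]; have [L L0 hL] := orbit_span_bound subG R (spanF x).
exists L => k; have := hL (fun m => cmod (h k m)) 1 ler01.
rewrite h0 cmod0 => /(_ erefl (hB k) (h1 k) 1 (subgroup1 subG)).
by rewrite mul1r mulr1.
Qed.

Definition nontrivial_functional (h : M -> C) :=
  [/\ forall x y, h (x + y) = h x + h y, orbit_bounded (fun m => cmod (h m)) & exists m, h m != 0].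

Definition ulimit (h : nat -> M -> C) (m : M) : C := culim U (fun k => h k m).

(** Pointwise boundedness turns the defect of additivity into a multiple of [1 / (k + 1)], with
    limit 0; the lower bound on the finite list [F] keeps the limit nonzero. *)
Lemma ulimit_functional h : normalized h -> nontrivial_functional (ulimit h).
Proof.
move=> nh; have bh x := normalized_bounded x nh; case: (nh) => h0 hB h1 h2 hD.
have add x y : ulimit h (x + y) = ulimit h x + ulimit h y.
  rewrite /ulimit.
  have [B xB] := bh x; have [B' yB] := bh y.
  have d0 : culim U (fun k => h k (x + y) - (h k x + h k y)) = 0.
    apply: (culim0 UU UN (B := B * B')) => k; apply: (le_trans (hD k x y)).
    rewrite ler_pM2r ?invr_gt0 ?ltr0n //.
    by apply: ler_pM; rewrite ?cmod_ge0.
  have bS := bounded_seqD (bh x) (bh y).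
  rewrite -[RHS]add0r -d0 -(culimD UU) // -(culimD UU) //.
    by congr (culim U _); apply/funext => k; rewrite subrK.
  exists (B * B') => k; apply: (le_trans (hD k x y)).
  rewrite ler_pdivrMr ?ltr0n // -[X in X <= _]mulr1.
  apply: ler_pM; rewrite ?ler1n // ?mulr_ge0 ?cmod_ge0 //.
  by apply: ler_pM; rewrite ?cmod_ge0.
split=> //.
  exists 1 => g f gG fF /=; have cv := cvg_ulim_cmod UU (bh (g * f)).
  have UP : ProperFilter U := @ultra_proper _ _ UU.
  by apply: (cvgr_to_le cv); apply: filterE => k; exact: h1.
have [|f fF hf] := @culim_neq0 R U UU M F (fun f k => h k f) (1 / 2) _ bh h2.
  by lra.
by exists f.
Qed.

(** Ultralimits respect products of bounded sequences, and the error in the eigenvalue equation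
    tends to 0 at each [x]. *)
Lemma ulimit_eigen h (a : M) (l : nat -> C) : normalized h -> (forall k, cmod (l k) = 1) ->
  (forall x, exists L, forall k, cmod (h k (a * x) - l k * h k x) <= L / k.+1%:R) ->
  cmod (culim U l) = 1 /\ forall x, ulimit h (a * x) = culim U l * ulimit h x.
Proof.
move=> nh l1 hl; have bh x := normalized_bounded x nh.
have bl : bounded_seq l by exists 1 => k; rewrite l1.
have UP : ProperFilter U := @ultra_proper _ _ UU.
split.
  have := cvg_ulim_cmod UU bl; rewrite (funext l1) => h1.
  rewrite -(ulim_uniq UU h1); apply: (ulim_uniq UU); exact: cvg_cst.
move=> x; have [L hL] := hl x.
rewrite /ulimit -(culimM UU) // -[RHS]add0r -(culim0 UU UN hL) -(culimD UU) //.
- by congr (culim U _); apply/funext => k; rewrite subrK.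
- exists L => k; apply: (le_trans (hL k)).
  have L0 : 0 <= L by have := le_trans (cmod_ge0 _) (hL 0%N); rewrite divr1.
  by rewrite ler_pdivrMr ?ltr0n // ler_peMr // ler1n.
- exact: bounded_seqM.
Qed.

(** The supremum need not be attained, but some [g f] reaches half of it; translating by [g] moves
    this large value onto [F] and keeps the orbit bound. *)
Lemma normalize_orbit (u : M -> C) (c := orbit_sup (fun m => cmod (u m))) :
  orbit_bounded (fun m => cmod (u m)) -> 0 < c ->
  exists2 g, g \in G &
    (forall g' f, g' \in G -> f \in F -> cmod (u (g * (g' * f)) / c%:C%C) <= 1) /\
    exists2 f, f \in F & 1 / 2 <= cmod (u (g * f) / c%:C%C).
Proof.
move=> bu c0; have cc x : cmod (x / c%:C%C) = cmod x / c.
  by rewrite cmodM cmodV cmod_real gtr0_norm.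
have [g [f [gG fF gf]]] := orbit_sup_attained bu c0.
exists g => //; split=> [g' f' gG' fF'|].
  by rewrite cc ler_pdivrMr // mul1r mulrA; apply: orbit_sup_ub => //; exact: subgroupM.
by exists f => //; rewrite cc ler_pdivlMr // mulrC; move: gf; rewrite /c mul1r.
Qed.

Lemma orbit_sup_gt0 (u : M -> C) : orbit_bounded (fun m => cmod (u m)) -> u 0 = 0 ->
  (forall x y, cmod (u (x - y)) <= cmod (u x) + cmod (u y)) -> (exists x, u x != 0) ->
  0 < orbit_sup (fun m => cmod (u m)).
Proof.
move=> bu u0 uB [x ux]; rewrite ltNge; apply/negP => s0.
have := @orbit_zero (fun m => cmod (u m)) (fun m => cmod_ge0 (u m)) _ uB _ x.
rewrite u0 cmod0 => /(_ erefl) h; move: ux; rewrite -cmod_eq0 h ?eqxx // => g f gG fF.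
by apply: le_trans s0; exact: (orbit_sup_ub bu gG fF).
Qed.

(** For [u = chi - 1] the defect [u(x + y) - u(x) - u(y)] is the product [u(x) u(y)]. After division
    by the orbit supremum [c] it is [c] times the product of the rescaled values, and
    [c <= 1 / (k + 1)]. *)
Lemma functional_of_chars :
  (forall e : R, 0 < e -> exists chi, [/\ is_char chi,
    forall g f, g \in G -> f \in F -> cmod (chi (g * f) - 1) < e &
    exists x : M, chi x != 1]) ->
  exists h, nontrivial_functional h.
Proof.
move=> H; have /choice[chi chiP] : forall k : nat, exists chi : M -> C, [/\ is_char chi,
    forall g f, g \in G -> f \in F -> cmod (chi (g * f) - 1) < k.+1%:R^-1 &
    exists x : M, chi x != 1].
  by move=> k; apply: H; rewrite invr_gt0 ltr0n.
pose u k m := chi k m - 1; pose c k := orbit_sup (fun m => cmod (u k m)).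
have cD k x y : chi k (x + y) = chi k x * chi k y by case: (chiP k) => -[].
have c1 k x : cmod (chi k x) = 1 by case: (chiP k) => -[].
have chi0 k : chi k 0 = 1.
  have nz : chi k 0 != 0 by rewrite -cmod_eq0 c1 oner_eq0.
  by apply: (mulfI nz); rewrite -cD addr0 mulr1.
have u0 k : u k 0 = 0 by rewrite /u chi0 subrr.
have uB k x y : cmod (u k (x - y)) <= cmod (u k x) + cmod (u k y).
  (* Multiplying by the unimodular [chi k y] turns the left side into the modulus of
     [chi k x - chi k y]. *)
  rewrite -[X in X <= _]mulr1 -(c1 k y) -cmodM /u mulrBl mul1r -cD subrK.
  have -> : chi k x - chi k y = (chi k x - 1) + - (chi k y - 1) by ring.
  by apply: (le_trans (cmodD _ _)); rewrite cmodN.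
have bu k : orbit_bounded (fun m => cmod (u k m)).
  by exists k.+1%:R^-1 => g f gG fF; apply: ltW; case: (chiP k) => _ + _; exact.
have c_gt0 k : 0 < c k.
  apply: orbit_sup_gt0 => //; case: (chiP k) => _ _ [x hx]; exists x.
  by rewrite subr_eq0.
have c_le k : c k <= k.+1%:R^-1.
  by apply: orbit_sup_le => g f gG fF; apply: ltW; case: (chiP k) => _ + _; exact.
have /choice[g gP] : forall k, exists g, g \in G /\
    ((forall g' f, g' \in G -> f \in F -> cmod (u k (g * (g' * f)) / (c k)%:C%C) <= 1) /\
    exists2 f, f \in F & 1 / 2 <= cmod (u k (g * f) / (c k)%:C%C)).
  by move=> k; have [g gG gP] := normalize_orbit (bu k) (c_gt0 k); exists g.
exists (ulimit (fun k m => u k (g k * m) / (c k)%:C%C)); apply: ulimit_functional.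
have cc k x : cmod (x / (c k)%:C%C) = cmod x / c k.
  by rewrite cmodM cmodV cmod_real gtr0_norm.
split.
- by move=> k; rewrite mulr0 u0 mul0r.
- by move=> k x y; rewrite !cc -mulrDl ler_pM2r ?invr_gt0 // mulrBr.
- by move=> k g' f; exact: (gP k).2.1.
- by move=> k; exact: (gP k).2.2.
- move=> k x y; rewrite mulrDr -mulrDl -mulrBl !cc.
  have -> : u k (g k * x + g k * y) - (u k (g k * x) + u k (g k * y)) =
    u k (g k * x) * u k (g k * y) by rewrite /u cD; ring.
  rewrite cmodM; set p := cmod _; set r := cmod _.
  have -> : p * r / c k = (p / c k * (r / c k)) * c k by field; rewrite gt_eqF.
  by apply: ler_wpM2l => //; rewrite mulr_ge0 // divr_ge0 ?cmod_ge0 // ltW.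
Qed.

Section EigenStep.
Variables (h : M -> C) (hP : nontrivial_functional h) (a : M) (aG : a \in G).

(** The functional [p(T) h] for the translation [(T h) m = h (a * m)]. *)
Definition poly_act (p : {poly C}) (m : M) : C :=
  \sum_(i < size p) p`_i * h (a ^+ i * m).

Let hD x y : h (x + y) = h x + h y. Proof. by case: hP. Qed.

Let h0 : h 0 = 0.
Proof. by apply: (addrI (h 0)); rewrite -hD !addr0. Qed.

Let hN x : h (- x) = - h x.
Proof. by apply/eqP; rewrite -addr_eq0 -hD addNr h0. Qed.

Lemma poly_act_wide n (p : {poly C}) m : (size p <= n)%N ->
  poly_act p m = \sum_(i < n) p`_i * h (a ^+ i * m).
Proof.
move=> pn; rewrite /poly_act (big_ord_widen n (fun i => p`_i * h (a ^+ i * m))) //.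
rewrite big_mkcond; apply: eq_bigr => i _; case: ltnP => // ip.
by rewrite nth_default // mul0r.
Qed.

Lemma poly_actD p r m : poly_act (p + r) m = poly_act p m + poly_act r m.
Proof.
pose n := maxn (size p) (size r).
rewrite !(@poly_act_wide n) ?leq_maxl ?leq_maxr ?size_polyD //.
by rewrite -big_split; apply: eq_bigr => i _; rewrite coefD mulrDl.
Qed.

Lemma poly_actZ c p m : poly_act (c *: p) m = c * poly_act p m.
Proof.
rewrite !(@poly_act_wide (size p)) ?size_scale_leq // mulr_sumr.
by apply: eq_bigr => i _; rewrite coefZ mulrA.
Qed.

Lemma poly_actX p m : poly_act ('X * p) m = poly_act p (a * m).
Proof.
rewrite (@poly_act_wide (size p).+1); last first.
  by apply: (leq_trans (size_polyMleq _ _)); rewrite size_polyX.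
rewrite big_ord_recl coefXM eqxx mul0r add0r; apply: eq_bigr => i _.
by rewrite coefXM /= /bump /= add1n exprSr mulrA.
Qed.

Lemma poly_act1 m : poly_act 1 m = h m.
Proof. by rewrite /poly_act size_poly1 big_ord1 coef1 eqxx expr0 !mul1r. Qed.

Lemma poly_act_add p x y : poly_act p (x + y) = poly_act p x + poly_act p y.
Proof.
by rewrite -big_split; apply: eq_bigr => i _; rewrite mulrDr hD mulrDr.
Qed.

Lemma poly_act_eigen p b mu m : (forall x, h (b * x) = mu * h x) ->
  poly_act p (b * m) = mu * poly_act p m.
Proof.
move=> hb; rewrite mulr_sumr; apply: eq_bigr => i _.
by rewrite mulrCA hb mulrCA.
Qed.

Lemma subgroupX i : a ^+ i \in G.
Proof.
by elim: i => [|i IH]; [exact: subgroup1 | rewrite exprS; exact: subgroupM].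
Qed.

Lemma poly_act_bounded p : orbit_bounded (fun m => cmod (poly_act p m)).
Proof.
case: hP => _ [B hB] _; exists (\sum_(i < size p) cmod p`_i * B) => g f gG fF.
rewrite /poly_act; apply: (big_ind2 (fun (x : C) (y : R) => cmod x <= y)).
- by rewrite cmod0.
- by move=> x r y s hx hy; apply: (le_trans (cmodD _ _)); exact: lerD.
- move=> i _; rewrite cmodM; apply: ler_wpM2l; first exact: cmod_ge0.
  by rewrite mulrA; apply: hB => //; apply: subgroupM => //; exact: subgroupX.
Qed.

Let q p := orbit_sup (fun m => cmod (poly_act p m)).

Let qD p r : q (p + r) <= q p + q r.
Proof.
apply: orbit_sup_le => g f gG fF; rewrite poly_actD.
apply: (le_trans (cmodD _ _)); apply: lerD.
  exact: (orbit_sup_ub (poly_act_bounded p)).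
exact: (orbit_sup_ub (poly_act_bounded r)).
Qed.

Let qZ_le c p : q (c *: p) <= cmod c * q p.
Proof.
apply: orbit_sup_le => g f gG fF; rewrite poly_actZ cmodM.
by apply: ler_wpM2l; [exact: cmod_ge0 | exact: (orbit_sup_ub (poly_act_bounded p))].
Qed.

Let q_ge0 p : 0 <= q p.
Proof.
have [f fF] := generators_neq_nil.
apply: le_trans (orbit_sup_ub (poly_act_bounded p) (subgroup1 subG) fF).
exact: cmod_ge0.
Qed.

Let qZ c p : q (c *: p) = cmod c * q p.
Proof.
apply/eqP; rewrite eq_le qZ_le /=; have [->|c0] := eqVneq c 0.
  by rewrite cmod0 mul0r.
have cc : 0 < cmod c by rewrite cmod_gt0.
rewrite mulrC -ler_pdivlMr // mulrC -cmodV.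
by apply: le_trans (qZ_le _ _); rewrite scalerA mulVf // scale1r.
Qed.

(** Multiplication by [a] permutes [G], so both sides are suprema over the same orbits. *)
Let qX p : q ('X * p) = q p.
Proof.
apply/eqP; rewrite eq_le; apply/andP; split; apply: orbit_sup_le => g f gG fF.
  rewrite poly_actX mulrA; apply: (orbit_sup_ub (poly_act_bounded p)) => //.
  exact: subgroupM.
have -> : g * f = a * ((a^-1 * g) * f).
  by rewrite !mulrA divrr ?mul1r //; exact: subgroup_unit aG.
rewrite -poly_actX; apply: (orbit_sup_ub (poly_act_bounded _)) => //.
by apply: subgroupM => //; exact: subgroupV.
Qed.

Let poly_act_sub p x y : cmod (poly_act p (x - y)) <= cmod (poly_act p x) + cmod (poly_act p y).
Proof.
rewrite -(cmodN (poly_act p y)).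
have -> : - poly_act p y = poly_act p (- y).
  by rewrite -sumrN; apply: eq_bigr => i _; rewrite mulrN hN mulrN.
by rewrite poly_act_add; exact: cmodD.
Qed.

Let poly_act0 p : poly_act p 0 = 0.
Proof. by rewrite /poly_act big1 // => i _; rewrite mulr0 h0 mulr0. Qed.

Let q1 : 0 < q 1.
Proof.
apply: orbit_sup_gt0; rewrite ?poly_act0 //; first exact: poly_act_bounded.
by case: hP => _ _ [m hm]; exists m; rewrite poly_act1.
Qed.

(** The functionals [p_k(T) h] are approximate eigenvectors with error [1 / (k + 1)]; their
    normalized ultralimit is an exact one. Eigenvalues of [h] for other elements [b] persist,
    because translation by [b] commutes with [p_k(T)]. *)
Lemma eigen_step : exists h' l, [/\ nontrivial_functional h', cmod l = 1,
  forall x, h' (a * x) = l * h' x &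
  forall b mu, (forall x, h (b * x) = mu * h x) -> forall x, h' (b * x) = mu * h' x].
Proof.
have /choice[lp lpP] : forall k : nat, exists lp : C * {poly C},
    cmod lp.1 = 1 /\ q (('X - lp.1%:P) * lp.2) < k.+1%:R^-1 * q lp.2.
  move=> k; have k0 : (0 : R) < k.+1%:R^-1 by rewrite invr_gt0 ltr0n.
  have [l [p lpP]] := approximate_eigenvalue qD qZ qX q1 k0.
  by exists (l, p).
pose l k := (lp k).1; pose p k := (lp k).2; pose c k := q (p k).
have l1 k : cmod (l k) = 1 by exact: (lpP k).1.
have lt k : q (('X - (l k)%:P) * p k) < k.+1%:R^-1 * c k by exact: (lpP k).2.
have c0 k : 0 < c k.
  by have := le_lt_trans (q_ge0 _) (lt k); rewrite pmulr_rgt0 // invr_gt0 ltr0n.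
have /choice[g gP] : forall k, exists g, g \in G /\
    ((forall g' f, g' \in G -> f \in F -> cmod (poly_act (p k) (g * (g' * f)) / (c k)%:C%C) <= 1) /\
    exists2 f, f \in F & 1 / 2 <= cmod (poly_act (p k) (g * f) / (c k)%:C%C)).
  by move=> k; have [g gG gP] := normalize_orbit (poly_act_bounded (p k)) (c0 k); exists g.
have cc k x : cmod (x / (c k)%:C%C) = cmod x / c k.
  by rewrite cmodM cmodV cmod_real gtr0_norm.
pose hk k m := poly_act (p k) (g k * m) / (c k)%:C%C.
have nh : normalized hk.
  split.
  - by move=> k; rewrite /hk mulr0 poly_act0 mul0r.
  - by move=> k x y; rewrite /hk !cc -mulrDl ler_pM2r ?invr_gt0 // mulrBr.
  - by move=> k g' f; exact: (gP k).2.1.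
  - by move=> k; exact: (gP k).2.2.
  - move=> k x y; rewrite /hk mulrDr poly_act_add mulrDl subrr cmod0.
    by rewrite !mulr_ge0 ?cmod_ge0 // invr_ge0 ler0n.
have act k x : hk k (a * x) - l k * hk k x =
    poly_act (('X - (l k)%:P) * p k) (g k * x) / (c k)%:C%C.
  have -> : ('X - (l k)%:P) * p k = 'X * p k + (- l k) *: p k.
    by rewrite mulrBl scaleNr mul_polyC.
  by rewrite poly_actD poly_actX poly_actZ /hk mulrCA; ring.
(* The error is small on the orbits of [F] by the choice of [p k], and the span bound carries this
   to every [x]. *)
have close x : exists L, forall k, cmod (hk k (a * x) - l k * hk k x) <= L / k.+1%:R.
  have [L L0 hL] := orbit_span_bound subG R (spanF x); exists L => k.
  have := hL (fun x => cmod (hk k (a * x) - l k * hk k x)) k.+1%:R^-1 _ _ _ _ 1 (subgroup1 subG).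
  rewrite mul1r; apply.
  - by rewrite invr_ge0 ler0n.
  - by rewrite act mulr0 poly_act0 mul0r cmod0.
  - by move=> y z; rewrite !act !cc -mulrDl ler_pM2r ?invr_gt0 // mulrBr.
  - move=> g' f gG fF; rewrite act cc ler_pdivrMr // mulrA; apply: ltW.
    apply: le_lt_trans (lt k); apply: (orbit_sup_ub (poly_act_bounded _)) => //.
    by apply: subgroupM => //; exact: (gP k).1.
have [L1 L2] := ulimit_eigen nh l1 close.
exists (ulimit hk), (culim U l); split=> //; first exact: ulimit_functional.
move=> b mu hb x; rewrite /ulimit -[in RHS](culim_cst UU mu) -(culimM UU) //.
- by congr (culim U _); apply/funext => k; rewrite /hk mulrCA (poly_act_eigen _ _ hb) mulrA.
- exact: bounded_seq_cst.
- exact: normalized_bounded.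
Qed.

End EigenStep.

End JointEigenfunction.

(** * Joint eigenfunctions for a sequence, and the resulting unitary homomorphism *)

Section UnitaryHomomorphismExists.
Variables (R : realType) (M : idomainType) (G : {pred M}) (subG : unit_subgroup G).
Variables (F : seq M) (spanF : forall m, orbit_span G F m).
Variables (U : set_system nat) (UU : UltraFilter U) (UN : \oo `<=` U).
Local Notation C := R[i].
Local Notation functional := (@nontrivial_functional R M G F).

Lemma finite_joint_eigen (h : M -> C) (e : nat -> M) n : functional h ->
  (forall j, e j \in G) ->
  exists h' l, [/\ functional h', forall j : nat, cmod (l j) = 1 &
    forall j, (j < n)%N -> forall x, h' (e j * x) = l j * h' x].
Proof.
move=> hP eG; elim: n => [|n [h' [l [hP' l1 hl]]]].
  by exists h, (fun=> 1); split=> // j; exact: cmod1.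
have [h2 [l2 [hP2 l21 h2n h2b]]] := eigen_step subG spanF UU UN hP' (eG n).
exists h2, (fun j => if j == n then l2 else l j); split=> // [j|j].
  by case: ifP.
by rewrite ltnS leq_eqVlt; case: eqVneq => [->|_ /=] //; move/hl/h2b.
Qed.

(** The [n]-th function is an eigenfunction for the first [n] elements. For each fixed [j] all but
    finitely many are therefore exact, and their normalized ultralimit is an eigenfunction for every
    [e j]. *)
Lemma joint_eigen (h : M -> C) (e : nat -> M) : functional h -> (forall j, e j \in G) ->
  exists h', functional h' /\
    forall j, exists2 l, cmod l = 1 & forall x, h' (e j * x) = l * h' x.
Proof.
move=> hP eG.
have /choice[hl hlP] : forall n : nat, exists hl : (M -> C) * (nat -> C),
    [/\ functional hl.1, forall j, cmod (hl.2 j) = 1 &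
      forall j, (j < n)%N -> forall x, hl.1 (e j * x) = hl.2 j * hl.1 x].
  by move=> n; have [h' [l hl]] := finite_joint_eigen n hP eG; exists (h', l).
pose u n := (hl n).1; pose l n := (hl n).2.
have uP n : functional (u n) by case: (hlP n).
have uD n x y : u n (x + y) = u n x + u n y by case: (uP n) => + _ _; exact.
have u0 n : u n 0 = 0 by apply: (addrI (u n 0)); rewrite -uD !addr0.
have uN n x : u n (- x) = - u n x.
  by apply/eqP; rewrite -addr_eq0 -uD addNr u0.
have uB n x y : cmod (u n (x - y)) <= cmod (u n x) + cmod (u n y).
  by rewrite uD uN -(cmodN (u n y)); exact: cmodD.
have bu n : orbit_bounded G F (fun m => cmod (u n m)) by case: (uP n).
pose c n := orbit_sup G F (fun m => cmod (u n m)).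
have c0 n : 0 < c n.
  by apply: (orbit_sup_gt0 subG spanF) => //; case: (uP n).
have cc k x : cmod (x / (c k)%:C%C) = cmod x / c k.
  by rewrite cmodM cmodV cmod_real gtr0_norm.
have /choice[g gP] : forall k, exists g, g \in G /\
    ((forall g' f, g' \in G -> f \in F -> cmod (u k (g * (g' * f)) / (c k)%:C%C) <= 1) /\
    exists2 f, f \in F & 1 / 2 <= cmod (u k (g * f) / (c k)%:C%C)).
  by move=> k; have [g gG gP] := normalize_orbit subG spanF (bu k) (c0 k); exists g.
pose hk k m := u k (g k * m) / (c k)%:C%C.
have nh : normalized G F hk.
  split.
  - by move=> k; rewrite /hk mulr0 u0 mul0r.
  - by move=> k x y; rewrite /hk !cc -mulrDl ler_pM2r ?invr_gt0 // mulrBr.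
  - by move=> k g' f; exact: (gP k).2.1.
  - by move=> k; exact: (gP k).2.2.
  - move=> k x y; rewrite /hk mulrDr uD mulrDl subrr cmod0.
    by rewrite !mulr_ge0 ?cmod_ge0 // invr_ge0 ler0n.
exists (ulimit U hk); split; first exact: (ulimit_functional subG spanF UU UN nh).
move=> j; have l1 k : cmod (l k j) = 1 by case: (hlP k) => _ h1 _; exact: h1.
suff close x : exists L, forall k, cmod (hk k (e j * x) - l k j * hk k x) <= L / k.+1%:R.
  have [L1 L2] := ulimit_eigen subG spanF UU UN nh l1 close.
  by exists (culim U (fun k => l k j)).
have [B xB] := normalized_bounded subG spanF (e j * x) nh.
have [B' xB'] := normalized_bounded subG spanF x nh.
have B0 : 0 <= B by exact: le_trans (cmod_ge0 _) (xB 0%N).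
have B0' : 0 <= B' by exact: le_trans (cmod_ge0 _) (xB' 0%N).
(* For [k > j] the error is 0. For [k <= j] it is at most [B + B'], and the factor [j + 1]
   compensates the division by [k + 1]. *)
exists ((B + B') * j.+1%:R) => k; have [kj|jk] := leqP k j.
  apply: (@le_trans _ _ (B + B')).
    apply: (le_trans (cmodD _ _)); rewrite cmodN cmodM l1 mul1r.
    exact: lerD.
  by rewrite ler_pdivlMr ?ltr0n // ler_wpM2l ?addr_ge0 // ler_nat ltnS.
have -> : hk k (e j * x) = l k j * hk k x.
  have H y : u k (e j * y) = l k j * u k y by case: (hlP k) => _ _ /(_ j jk); exact.
  by rewrite /hk mulrCA H mulrA.
by rewrite subrr cmod0 divr_ge0 ?ler0n // mulr_ge0 ?ler0n ?addr_ge0.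
Qed.

(** The elements acting on [h] by a scalar form a subring containing [G], hence [M_G]. As [h m] is
    nonzero the scalar is unique, which makes it additive and multiplicative. *)
Lemma unitary_hom_of_eigen (h : M -> C) : functional h ->
  (forall g, g \in G -> exists2 l, cmod l = 1 & forall x, h (g * x) = l * h x) ->
  exists phi : {rmorphism gen_subring_of G -> C},
    forall a, gen_subring_val a \in G -> cmod (phi a) = 1.
Proof.
move=> [hD _ [m hm]] hG.
have h0 : h 0 = 0 by apply: (addrI (h 0)); rewrite -hD !addr0.
have hB x y : h (x - y) = h x - h y.
  by apply/eqP; rewrite eq_sym subr_eq -hD subrK.
have hA a : a \in gen_subring G -> exists l, forall x, h (a * x) = l * h x.
  move: a; apply: (gen_subring_ind (P := fun a => exists l, forall x, h (a * x) = l * h x)).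
  - by exists 1 => x; rewrite !mul1r.
  - by move=> a b [l hl] [l' hl']; exists (l - l') => x; rewrite !mulrBl hB hl hl'.
  - by move=> a b [l hl] [l' hl']; exists (l * l') => x; rewrite -!mulrA hl hl'.
  - by move=> g /hG[l _ hl]; exists l.
pose phi (a : gen_subring_of G) : C := h (gen_subring_val a * m) / h m.
have phiE a x : h (gen_subring_val a * x) = phi a * h x.
  have [l hl] := hA _ (gen_subringP a).
  by rewrite hl /phi hl mulfK.
have phiB : zmod_morphism phi.
  move=> a b; apply: (mulIf hm); rewrite [RHS]mulrBl -!phiE -hB.
  by congr h; rewrite -mulrBl.
have phiM : monoid_morphism phi.
  split; first by apply: (mulIf hm); rewrite -(phiE 1) !mul1r.
  by move=> a b; apply: (mulIf hm); rewrite -[RHS]mulrA -(phiE (a * b)) -(phiE b) -(phiE a) mulrA.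
pose phi' : {rmorphism gen_subring_of G -> C} := HB.pack phi
  (GRing.isZmodMorphism.Build _ _ phi phiB) (GRing.isMonoidMorphism.Build _ _ phi phiM).
exists phi' => a aG; have [l l1 hl] := hG _ aG.
by rewrite [phi' a](_ : _ = l) //= /phi hl mulfK.
Qed.

End UnitaryHomomorphismExists.

(** * Logarithmic maps trivial on the group, and the equivalence *)

Lemma log_map_unitary (R : realType) (M : idomainType) (G : {pred M})
    (subG : unit_subgroup G) (phi : {rmorphism gen_subring_of G -> R[i]}) :
  log_map phi @` [set a | gen_subring_val a \in G] = [set Some 0] <->
  forall a, gen_subring_val a \in G -> cmod (phi a) = 1.
Proof.
split=> [H a aG|H].
  have : [set Some 0] (log_map phi a) by rewrite -H; exists a.
  (* The infinite value is excluded, and [ln] is injective on positive numbers, so a zero logarithm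
     forces modulus 1. *)
  rewrite /= /log_map; case: eqVneq => // phia0 [].
  have c0 : 0 < cmod (phi a) by rewrite cmod_gt0.
  by rewrite -ln1 => /ln_inj; apply; rewrite posrE.
have H0 a : gen_subring_val a \in G -> log_map phi a = Some 0.
  move=> aG; rewrite /log_map -cmod_eq0 (H a aG) oner_eq0.
  by congr Some; rewrite -[complex.Re _]/(cmod (phi a)) H // ln1.
apply/seteqP; split=> [_ [a aG <-]|_ ->] /=; first exact: H0.
by exists 1; [exact: subgroup1 | apply: H0; exact: subgroup1].
Qed.

Theorem proposition4p1 (R : realType) (M : idomainType) (G : {pred M})
    (G_subgroup : unit_subgroup G) (G_countable : countable [set` G])
    (M_fin_gen : fin_gen_algebra G) :
  expansive (@induced_action R M) [set` G] <->
  (forall v : gen_subring_of G -> option R,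
     log_maps v -> v @` [set a | gen_subring_val a \in G] <> [set Some 0]) /\
  (forall (H : porderZmodType) (v : {fraction M} -> option H),
     ordered_group H -> valuations_ZarC v ->
     (v \o @FracField.tofrac M) @` [set` G] <> [set Some 0]).
Proof.
rewrite (expansiveP R G_subgroup); split.
  move=> [F [e [e0 expF]]].
  have spanF := expansive_orbit_span G_subgroup e0 expF.
  split=> [_ [phi ->] /(log_map_unitary G_subgroup) phi1|H v _ [_ [[Vring Vtot _] VM]] vG].
    have [chi [chiP small [x /eqP]]] := unitary_not_expansive e0 spanF phi1.
    by apply; exact: expF.
  (* Values 0 put [G] inside the valuation ring; since [F] spans [M], all of [M] then lies in it. *)
  apply: VM; split=> // _ [m _ <-].
  apply: (orbit_span_valuation spanF Vring Vtot) => g gG.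
  have : [set Some 0] (v (FracField.tofrac g)) by rewrite -vG; exists g.
  by move=> vg; rewrite /in_mem /= /valuation_ring vg /= lexx.
move=> [V1 V2]; have int := valuations_integral G_subgroup V2.
have [F spanF] := integral_fin_gen G_subgroup M_fin_gen int.
apply: contrapT => nexp.
(* If for some [e] there were no such character, [F] and [e] would witness expansiveness. *)
have chars (e : R) : 0 < e -> exists chi, [/\ is_char chi,
    forall g f, g \in G -> f \in F -> cmod (chi (g * f) - 1) < e &
    exists x : M, chi x != 1].
  move=> e0; apply: contrapT => H; apply: nexp; exists F, e; split=> // chi chiP small x.
  by apply: contrapT => /eqP hx; apply: H; exists chi; split=> //; exists x.
have [U [UU UN]] := @ultraFilterLemma nat \oo _.
have [h hP] := functional_of_chars G_subgroup spanF UU UN chars.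
have [e eG esurj] : exists2 e : nat -> M, forall j, e j \in G &
    forall g, g \in G -> exists j, e j = g.
  have /countable_injP[f finj] := G_countable.
  have G1 := subgroup1 G_subgroup.
  (* Indices outside the range of the injection [f] get the default 1, which is in [G]. *)
  exists (fun j => if pselect (exists2 g, g \in G & f g = j) is left p then projT1 (cid2 p) else 1).
    by move=> j; case: pselect => // p; case: cid2.
  move=> g gG; exists (f g); case: pselect => [p|[]]; last by exists g.
  by case: cid2 => g' /= g'G fE; apply: finj => //; rewrite inE.
have [h' [hP' hl]] := joint_eigen G_subgroup spanF UU UN hP eG.
have hG g : g \in G -> exists2 l, cmod l = 1 & forall x, h' (g * x) = l * h' x.
  by move=> /esurj[j <-]; exact: hl.
have [phi phi1] := unitary_hom_of_eigen hP' hG.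
by apply: (V1 (log_map phi)); [exists phi | apply/log_map_unitary].
Qed.
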